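(* For the speed-scaling scheduling problems $P|size_j,r_j=r,d_j|E$ (common release time $r$, individual deadlines) and $P|size_j,r_j,d_j=d|E$ (individual release times, common deadline $d$), without preemption and without migration, restricted to instances in which every job satisfies $size_j\le\frac{m}{2}$, there is an algorithm running in $O(n^2)$ time that returns a feasible schedule whose total energy consumption is at most $\left(3-\frac{4}{m+1}\right)^{\alpha-1}$ times the minimum possible total energy consumption.
   Context: A system has $m$ identical parallel processors whose speeds can be changed dynamically over a continuous spectrum. A set $\mathcal{J}=\{1,\dots,n\}$ of rigid parallel jobs is given; job $j$ has a release time $r_j$, a deadline $d_j$, a processing volume (work) $W_j>0$ and a size $size_j$, the number of processors it requires simultaneously. Any subset of $size_j$ processors may be used to execute job $j$; each job is processed without interruption (no preemption) on one fixed set of $size_j$ processors (no migration). All processors executing the same job at the same time run at the same speed; the speed of a job is the rate at which its work is completed. Running a processor at speed $s$ consumes power $s^\alpha$, where $\alpha>1$ is a constant, and energy is power integrated over time (summed over all processors). A schedule is feasible if each processor executes at most one job at a time and each job $j$ has its whole work $W_j$ processed within $[r_j,d_j)$. The objective $E$ is to minimize the total energy consumption; $r_j=r$ (resp. $d_j=d$) means all jobs have the same release time (resp. deadline). *)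

(* Defs.v *)
From mathcomp Require Import all_boot all_order all_algebra.
From mathcomp Require Import all_classical all_reals all_analysis.

Set Implicit Arguments.
Unset Strict Implicit.
Unset Printing Implicit Defensive.

Import Order.TTheory GRing.Theory Num.Theory.
Import numFieldNormedType.Exports.

Local Open Scope classical_set_scope.
Local Open Scope ring_scope.

(* Jobs and processors are numbered from 0. *)
Record instance (R : realType) := Instance {
  njobs : nat;
  nprocs : nat;
  release : 'I_njobs -> R;
  deadline : 'I_njobs -> R;
  work : 'I_njobs -> R;
  jsize : 'I_njobs -> nat }.

(* An empty window [release, deadline) would leave no feasible schedule. *)
Definition valid (R : realType) (I : instance R) : Prop :=
  (0 < nprocs I)%N /\
  forall j : 'I_(njobs I),
    [/\ release j < deadline j, 0 < work j, (0 < jsize j)%N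
      & (jsize j <= nprocs I)%N].

Definition common_release (R : realType) (I : instance R) : Prop :=
  exists r : R, forall j : 'I_(njobs I), release j = r.

Definition common_deadline (R : realType) (I : instance R) : Prop :=
  exists d : R, forall j : 'I_(njobs I), deadline j = d.

Definition half_size (R : realType) (I : instance R) : Prop :=
  forall j : 'I_(njobs I), (jsize j)%:R <= (nprocs I)%:R / 2 :> R.

(* Job j runs during the single interval [start j, finish j), on the single set
   procs j, at speed [speed j t] at time t: neither preemption nor migration can
   be expressed. The values of [speed j] outside the interval are irrelevant. *)
Record schedule (R : realType) (n m : nat) := Schedule {
  procs : 'I_n -> {set 'I_m};
  start : 'I_n -> R;
  finish : 'I_n -> R;
  speed : 'I_n -> R -> R }.

Definition exec_itv (R : realType) (n m : nat) (sigma : schedule R n m)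
    (j : 'I_n) : set R :=
  `[start sigma j, finish sigma j[.

(* Speeds are arbitrary measurable functions of time, positive throughout the
   execution interval since a job is processed without interruption. *)
Definition feasible (R : realType) (I : instance R)
    (sigma : schedule R (njobs I) (nprocs I)) : Prop :=
  [/\ forall j, #|procs sigma j| = jsize j,
      forall j, [/\ release j <= start sigma j,
                    start sigma j < finish sigma j
                  & finish sigma j <= deadline j],
      forall j, [/\ measurable_fun (exec_itv sigma j) (speed sigma j),
                    forall t, exec_itv sigma j t -> 0 < speed sigma j t
                  & (\int[lebesgue_measure]_(t in exec_itv sigma j)
                       (speed sigma j t)%:E = (work j)%:E)%E]
    & forall (p : 'I_(nprocs I)) (t : R) (j k : 'I_(njobs I)),
        p \in procs sigma j -> p \in procs sigma k ->
        exec_itv sigma j t -> exec_itv sigma k t -> j = k].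

Definition energy (R : realType) (n m : nat) (alpha : R)
    (sigma : schedule R n m) : \bar R :=
  (\sum_(p < m) \sum_(j < n | p \in procs sigma j)
     \int[lebesgue_measure]_(t in exec_itv sigma j)
       ((speed sigma j t) `^ alpha)%:E)%E.

Definition min_energy (R : realType) (alpha : R) (I : instance R) : \bar R :=
  ereal_inf [set energy alpha sigma | sigma in @feasible R I].

(* Memory consists of infinite arrays, named by natural numbers, of naturals
   (usable as indices) and of reals; a scalar variable is cell 0 of an array.
   Real arithmetic is exact. There is no rounding from reals to naturals and no
   multiplication of naturals, and the only constants are naturals. *)

Inductive iexp : Type :=
| INum of nat
| IGet of nat & iexp
| IAdd of iexp & iexp
| ISub of iexp & iexp.

Inductive rexp : Type :=
| ROfInt of iexp
| RGet of nat & iexp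
| RAdd of rexp & rexp
| RSub of rexp & rexp
| RMul of rexp & rexp
| RDiv of rexp & rexp.

Inductive bexp : Type :=
| BLeI of iexp & iexp
| BLeR of rexp & rexp
| BNot of bexp
| BAnd of bexp & bexp.

Inductive cmd : Type :=
| Skip
| SetI of nat & iexp & iexp   (* array, index, value *)
| SetR of nat & iexp & rexp
| Seq of cmd & cmd
| If of bexp & cmd & cmd
| While of bexp & cmd.

Record state (R : realType) := State {
  imem : nat -> nat -> nat;
  rmem : nat -> nat -> R }.

Definition upd (V : Type) (mem : nat -> nat -> V) (a i : nat) (v : V) :
    nat -> nat -> V :=
  fun b k => if (b == a) && (k == i) then v else mem b k.

Fixpoint ieval (R : realType) (s : state R) (e : iexp) : nat :=
  match e with
  | INum k => k
  | IGet a i => imem s a (ieval s i)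
  | IAdd e1 e2 => (ieval s e1 + ieval s e2)%N
  | ISub e1 e2 => (ieval s e1 - ieval s e2)%N
  end.

Fixpoint reval (R : realType) (s : state R) (e : rexp) : R :=
  match e with
  | ROfInt i => (ieval s i)%:R
  | RGet a i => rmem s a (ieval s i)
  | RAdd e1 e2 => reval s e1 + reval s e2
  | RSub e1 e2 => reval s e1 - reval s e2
  | RMul e1 e2 => reval s e1 * reval s e2
  | RDiv e1 e2 => reval s e1 / reval s e2
  end.

Fixpoint beval (R : realType) (s : state R) (b : bexp) : bool :=
  match b with
  | BLeI e1 e2 => (ieval s e1 <= ieval s e2)%N
  | BLeR e1 e2 => reval s e1 <= reval s e2
  | BNot b1 => ~~ beval s b1
  | BAnd b1 b2 => beval s b1 && beval s b2
  end.

(* Unit cost per constant, memory access, arithmetic operation, comparison,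
   connective, assignment and branching. *)

Fixpoint icost (e : iexp) : nat :=
  match e with
  | INum _ => 1
  | IGet _ i => (icost i).+1
  | IAdd e1 e2 | ISub e1 e2 => (icost e1 + icost e2).+1
  end.

Fixpoint rcost (e : rexp) : nat :=
  match e with
  | ROfInt i | RGet _ i => (icost i).+1
  | RAdd e1 e2 | RSub e1 e2 | RMul e1 e2 | RDiv e1 e2 =>
      (rcost e1 + rcost e2).+1
  end.

Fixpoint bcost (b : bexp) : nat :=
  match b with
  | BLeI e1 e2 => (icost e1 + icost e2).+1
  | BLeR e1 e2 => (rcost e1 + rcost e2).+1
  | BNot b1 => (bcost b1).+1
  | BAnd b1 b2 => (bcost b1 + bcost b2).+1
  end.

(* [exec c s s' t]: from state s, the program c halts in state s' after t
   steps. *)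
Inductive exec (R : realType) : cmd -> state R -> state R -> nat -> Prop :=
| exec_skip s : exec Skip s s 1
| exec_seti s a i e :
    exec (SetI a i e) s
      (State (upd (imem s) a (ieval s i) (ieval s e)) (rmem s))
      (icost i + icost e).+1
| exec_setr s a i e :
    exec (SetR a i e) s
      (State (imem s) (upd (rmem s) a (ieval s i) (reval s e)))
      (icost i + rcost e).+1
| exec_seq c1 c2 s s1 s2 t1 t2 :
    exec c1 s s1 t1 -> exec c2 s1 s2 t2 -> exec (Seq c1 c2) s s2 (t1 + t2)
| exec_if b c1 c2 s s' t :
    exec (if beval s b then c1 else c2) s s' t ->
    exec (If b c1 c2) s s' (bcost b + t).+1
| exec_while_stop b c s :
    ~~ beval s b -> exec (While b c) s s (bcost b).+1
| exec_while_step b c s s1 s2 t1 t2 :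
    beval s b -> exec c s s1 t1 -> exec (While b c) s1 s2 t2 ->
    exec (While b c) s s2 (bcost b + t1 + t2).+1.

Definition tabulate (V : Type) (v0 : V) (n : nat) (f : 'I_n -> V) (i : nat) :
    V :=
  oapp f v0 (insub i).

(* Natural arrays: 0 = n (cell 0), 1 = m (cell 0), 2 = sizes.
   Real arrays: 0 = release times, 1 = deadlines, 2 = works.
   All other cells are zero. *)
Definition load (R : realType) (I : instance R) : state R :=
  State
    (fun a i => match a, i with
                | 0, 0 => njobs I
                | 1, 0 => nprocs I
                | 2, _ => tabulate 0%N (@jsize R I) i
                | _, _ => 0%N
                end)
    (fun a i => match a with
                | 0 => tabulate 0 (@release R I) i
                | 1 => tabulate 0 (@deadline R I) i
                | 2 => tabulate 0 (@work R I) i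
                | _ => 0
                end).

(* Real arrays: 3 = start times, 4 = (constant) speeds.
   Natural arrays: the processors of job j are given as a union of integer
   intervals [lo, hi), stored in arrays 5 (lo) and 6 (hi) from cell
   [imem s 3 j] on; [imem s 4 j] is the number of these intervals. Listing the
   processors one by one would already take time proportional to the sum of the
   sizes, which is not bounded in terms of n. *)
Definition output (R : realType) (I : instance R) (s : state R) :
    schedule R (njobs I) (nprocs I) :=
  Schedule
    (fun j => [set p : 'I_(nprocs I) |
       [exists q : 'I_(imem s 4 j),
          (imem s 5 (imem s 3 j + q) <= p < imem s 6 (imem s 3 j + q))%N]]%SET)
    (fun j => rmem s 3 j)
    (fun j => rmem s 3 j + work j / rmem s 4 j)
    (fun j _ => rmem s 4 j).

(* A single program, for all instances in the class K (in particular for all n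
   and m), running in time O(n^2) where n is the number of jobs, and returning a
   schedule within the factor [rho m] of the optimum. *)
Definition quadratic_approx_alg (R : realType) (alpha : R) (rho : nat -> R)
    (K : instance R -> Prop) : Prop :=
  exists (prog : cmd) (T : nat -> nat),
    (fun n : nat => (T n)%:R : R^o) =O_\oo (fun n : nat => (n ^ 2)%:R : R^o) /\
    forall I : instance R, valid I -> K I ->
      exists (s : state R) (t : nat),
        [/\ exec prog (load I) s t,
            (t <= T (njobs I))%N,
            feasible (output I s)
          & (energy alpha (output I s)
               <= (rho (nprocs I))%:E * min_energy alpha I)%E].

(* Main.v *)
Require Import Defs.
From mathcomp Require Import all_boot all_order all_algebra.
From mathcomp Require Import all_classical all_reals all_analysis.
From mathcomp Require Import measurable_realfun zify ring lra.

Set Implicit Arguments.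
Unset Strict Implicit.
Unset Printing Implicit Defensive.

Import Order.TTheory GRing.Theory Num.Theory.

Local Open Scope classical_set_scope.
Local Open Scope ring_scope.

(** Write [D j] for the window length [d_j - r_j]; reversing time turns a common
    deadline into a common release time, so both problems are solved by one
    algorithm working with the windows [0, D j).

    Relaxation: a job of size [z] and work [W] run for a time [x / z] at constant
    speed costs [(z W)^alpha x^(1 - alpha)]. In EDF order, every schedule
    satisfies [x_j <= z_j D_j] and [sum_(i <= k) x_i <= m D_k]. The minimum under
    these constraints is found greedily, by decreasing speed: the largest of the
    speeds forced by a single window, [W_j / D_j], or by a prefix, [(work not yet
    fixed) / (area left)], is given to the jobs forcing it. The speeds [v] so
    obtained satisfy [sum_j v_j^alpha (y_j - x_j) <= 0] for every admissible [y],
    and the tangent inequality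
    [s^alpha >= alpha v^(alpha - 1) s - (alpha - 1) v^alpha], integrated over each
    job of an arbitrary schedule, then bounds its energy from below.

    All speeds are multiplied by [c = 3 - 4 / (m + 1)], and the jobs are started in
    EDF order, each as early as [z_j] processors are free. As [z_j <= m / 2], more
    than half of the processors are busy before each start time [S], so
    [(m + 1) / 2 * S] is at most the area of the preceding jobs, whence job [j]
    ends by [D j]. Processors are handled as intervals with a common release
    time; each job adds one interval, so that a job takes time [O(n)]. *)

(** * Hoare rules with a static cost bound *)

(** The bound depends on no state. A loop is charged [N.+1] rounds, the last one paying for the
    failing test, and a branch its dearer side. *)
Fixpoint cost_bound (N : nat) (c : cmd) : nat :=
  match c with
  | Skip => 1
  | SetI _ i e => (icost i + icost e).+1
  | SetR _ i e => (icost i + rcost e).+1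
  | Seq c1 c2 => cost_bound N c1 + cost_bound N c2
  | If b c1 c2 => (bcost b + maxn (cost_bound N c1) (cost_bound N c2)).+1
  | While b c => N.+1 * (bcost b + cost_bound N c).+1
  end%N.

Fixpoint loop_depth (c : cmd) : nat :=
  match c with
  | Seq c1 c2 | If _ c1 c2 => maxn (loop_depth c1) (loop_depth c2)
  | While _ c => (loop_depth c).+1
  | _ => 0
  end%N.

(** Every level of nesting contributes one factor [N.+1], and sequences and branches are raised to
    the larger depth. The degree of the running time can thus be read off the syntax. *)
Lemma cost_bound_polynomial N c :
  (cost_bound N c <= cost_bound 0 c * N.+1 ^ loop_depth c)%N.
Proof.
elim: c => /= [|a i e|a i e|c1 IH1 c2 IH2|b c1 IH1 c2 IH2|b c IH];
  rewrite ?expn0 ?muln1 //.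
- have h1 : (N.+1 ^ loop_depth c1 <= N.+1 ^ maxn (loop_depth c1) (loop_depth c2))%N.
    by rewrite leq_pexp2l // leq_maxl.
  have h2 : (N.+1 ^ loop_depth c2 <= N.+1 ^ maxn (loop_depth c1) (loop_depth c2))%N.
    by rewrite leq_pexp2l // leq_maxr.
  rewrite mulnDl leq_add //; [apply: leq_trans IH1 _|apply: leq_trans IH2 _];
    by rewrite leq_mul2l ?h1 ?h2 orbT.
- set D := (N.+1 ^ _)%N.
  have D0 : (0 < D)%N by rewrite expn_gt0.
  have h1 : (N.+1 ^ loop_depth c1 <= D)%N.
    by rewrite leq_pexp2l // leq_maxl.
  have h2 : (N.+1 ^ loop_depth c2 <= D)%N.
    by rewrite leq_pexp2l // leq_maxr.
  rewrite -addSn -[in leqRHS]addSn mulnDl leq_add //; first exact: leq_pmulr.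
  rewrite geq_max; apply/andP; split.
    apply: leq_trans IH1 (leq_mul _ h1); exact: leq_maxl.
  apply: leq_trans IH2 (leq_mul _ h2); exact: leq_maxr.
- rewrite mul1n expnS mulnCA leq_mul2l /=.
  have D0 : (0 < N.+1 ^ loop_depth c)%N by rewrite expn_gt0.
  rewrite -!addSn mulnDl leq_add //; exact: leq_pmulr.
Qed.

(** Writes are over-approximated per array and not per cell, so that the side conditions of framing
    are decided by computation. *)
Fixpoint int_written (c : cmd) (a : nat) : bool :=
  match c with
  | SetI x _ _ => a == x
  | Seq c1 c2 | If _ c1 c2 => int_written c1 a || int_written c2 a
  | While _ c => int_written c a
  | _ => false
  end.

Fixpoint real_written (c : cmd) (a : nat) : bool :=
  match c with
  | SetR x _ _ => a == x
  | Seq c1 c2 | If _ c1 c2 => real_written c1 a || real_written c2 a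
  | While _ c => real_written c a
  | _ => false
  end.

Definition frame (R : realType) (c : cmd) (s s' : state R) : Prop :=
  (forall a k, ~~ int_written c a -> imem s' a k = imem s a k) /\
  (forall a k, ~~ real_written c a -> rmem s' a k = rmem s a k).

Lemma frame_refl (R : realType) c (s : state R) : frame c s s.
Proof. by []. Qed.

Lemma frame_trans (R : realType) c (s1 s2 s3 : state R) :
  frame c s1 s2 -> frame c s2 s3 -> frame c s1 s3.
Proof.
by move=> [h1 h2] [h3 h4]; split=> a k ha; rewrite ?h3 ?h4 // ?h1 ?h2.
Qed.

Lemma frame_sub (R : realType) c c' (s1 s2 : state R) :
  (forall a, int_written c a -> int_written c' a) ->
  (forall a, real_written c a -> real_written c' a) ->
  frame c s1 s2 -> frame c' s1 s2.
Proof.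
move=> hi hr [h1 h2]; split=> a k ha.
  by apply: h1; apply: contra ha; apply: hi.
by apply: h2; apply: contra ha; apply: hr.
Qed.

Lemma exec_frame (R : realType) c (s s' : state R) t :
  exec c s s' t -> frame c s s'.
Proof.
elim=> {c s s' t} //.
- by move=> s a i e; split=> b k //= /negbTE hb; rewrite /upd hb.
- by move=> s a i e; split=> b k //= /negbTE hb; rewrite /upd hb.
- move=> c1 c2 s s1 s2 t1 t2 _ h1 _ h2.
  apply: frame_trans (frame_sub _ _ h1) (frame_sub _ _ h2) => a /= -> //;
    exact: orbT.
- move=> b c1 c2 s s' t _; case: beval => h; apply: frame_sub h => a /= -> //;
    exact: orbT.
- by move=> b c s s1 s2 t1 t2 _ _ h1 _ h2; apply: frame_trans h1 h2.
Qed.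

(* Total correctness; [N] bounds the number of iterations of every loop. *)
Definition ends (R : realType) (N : nat) (c : cmd) (s : state R)
    (Q : state R -> Prop) : Prop :=
  exists s' t, [/\ exec c s s' t, (t <= cost_bound N c)%N & Q s'].

Section Rules.
Variables (R : realType) (N : nat).
Implicit Types (s : state R) (Q : state R -> Prop) (c : cmd).

(** What [c] cannot write is known afterwards for free, so specifications only have to mention
    changes. *)
Lemma ends_frame c s Q :
  ends N c s (fun s' => frame c s s' -> Q s') -> ends N c s Q.
Proof.
move=> [s' [t [h ht hQ]]]; exists s', t; split=> //; apply: hQ.
exact: exec_frame h.
Qed.

Lemma ends_mono c s Q Q' :
  (forall s', Q s' -> Q' s') -> ends N c s Q -> ends N c s Q'.
Proof. by move=> h [s' [t [h1 h2 h3]]]; exists s', t; split=> //; apply: h. Qed.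

Lemma ends_skip s Q : Q s -> ends N Skip s Q.
Proof. by move=> h; exists s, 1%N; split=> //; constructor. Qed.

Lemma ends_seti s Q a i e :
  Q (State (upd (imem s) a (ieval s i) (ieval s e)) (rmem s)) ->
  ends N (SetI a i e) s Q.
Proof. by move=> h; eexists; eexists; split; [apply: exec_seti|done|]. Qed.

Lemma ends_setr s Q a i e :
  Q (State (imem s) (upd (rmem s) a (ieval s i) (reval s e))) ->
  ends N (SetR a i e) s Q.
Proof. by move=> h; eexists; eexists; split; [apply: exec_setr|done|]. Qed.

Lemma ends_seq s Q c1 c2 :
  ends N c1 s (fun s1 => ends N c2 s1 Q) -> ends N (Seq c1 c2) s Q.
Proof.
move=> [s1 [t1 [h1 ht1 [s2 [t2 [h2 ht2 hQ]]]]]].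
exists s2, (t1 + t2)%N; split=> //; first exact: exec_seq h1 h2.
exact: leq_add.
Qed.

Lemma ends_if s Q b c1 c2 :
  (beval s b -> ends N c1 s Q) -> (~~ beval s b -> ends N c2 s Q) ->
  ends N (If b c1 c2) s Q.
Proof.
move=> h1 h2; have [s' [t [h ht hQ]]] :
    ends N (if beval s b then c1 else c2) s Q.
  by case: ifP => hb; [apply: h1|apply: h2; rewrite hb].
exists s', (bcost b + t).+1; split=> //; first exact: exec_if.
rewrite ltnS leq_add2l; apply: leq_trans ht _.
by case: ifP => _; rewrite ?leq_maxl ?leq_maxr.
Qed.

(** The invariant carries the number [k] of completed iterations; the obligation [k < N] under a
    true test yields termination and the cost bound together. *)
Lemma ends_while (Inv : nat -> state R -> Prop) s Q b c :
  Inv 0%N s ->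
  (forall k s', frame c s s' -> Inv k s' -> beval s' b ->
    (k < N)%N /\ ends N c s' (Inv k.+1)) ->
  (forall k s', frame c s s' -> Inv k s' -> ~~ beval s' b -> Q s') ->
  ends N (While b c) s Q.
Proof.
move=> h0 hstep hend.
(* Induction on a bound [d] for the number [N - k] of iterations that may remain. *)
have loop d : forall k s', (N - k <= d)%N -> (k <= N)%N -> frame c s s' ->
    Inv k s' -> exists s'' t, [/\ exec (While b c) s' s'' t,
      (t <= (N - k).+1 * (bcost b + cost_bound N c).+1)%N & Q s''].
  elim: d => [|d IH] k s' hd hk hf hI; case: (boolP (beval s' b)) => hb.
  - by have [] := hstep _ _ hf hI hb; lia.
  - exists s', (bcost b).+1; split; [exact: exec_while_stop|nia|].
    exact: hend hf hI hb.
  - have [hkN [s1 [t1 [e1 ht1 hI1]]]] := hstep _ _ hf hI hb.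
    have hf1 := frame_trans hf (exec_frame e1).
    have [||s2 [t2 [e2 ht2 hQ]]] := IH k.+1 s1 _ _ hf1 hI1; [lia|lia|].
    exists s2, (bcost b + t1 + t2).+1; split=> //.
      exact: exec_while_step hb e1 e2.
    rewrite -(subnSK hkN) mulSn; lia.
  - exists s', (bcost b).+1; split; [exact: exec_while_stop|nia|].
    exact: hend hf hI hb.
have [||s' [t [h1 h2 h3]]] := loop N 0%N s _ _ (frame_refl _ _) h0; [lia|lia|].
by exists s', t; split=> //; rewrite subn0 in h2.
Qed.

End Rules.

Notation IVar x := (IGet x (INum 0)).
Notation RVar x := (RGet x (INum 0)).

Definition For (x : nat) (c : cmd) : cmd :=
  Seq (SetI x (INum 0) (INum 0))
    (While (BNot (BLeI (IVar 0) (IVar x)))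
       (Seq c (SetI x (INum 0) (IAdd (IVar x) (INum 1))))).

(** The counter is incremented after the body has established [Inv], hence [Inv] must survive any
    change of the counter. The bound is read again at each test, hence the body must not write array
    0. *)
Lemma ends_for (R : realType) N (Inv : nat -> state R -> Prop) s Q x c :
  let n := imem s 0 0 in
  (n <= N)%N -> x != 0%N -> ~~ int_written c 0 -> ~~ int_written c x ->
  (forall k s' v, Inv k s' -> Inv k (State (upd (imem s') x 0 v) (rmem s'))) ->
  Inv 0%N s ->
  (forall k s', (k < n)%N -> frame (For x c) s s' -> imem s' x 0 = k ->
     Inv k s' -> ends N c s' (Inv k.+1)) ->
  (forall s', frame (For x c) s s' -> Inv n s' -> Q s') ->
  ends N (For x c) s Q.
Proof.
move=> n nN x0 c0 cx hstab h0 hstep hend.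
apply/ends_seq/ends_seti => /=.
set s1 := State _ _.
have f1 : frame (For x c) s s1.
  by split=> a k //=; rewrite !negb_or => /and3P[/negbTE ax _ _]; rewrite /upd ax.
have fr s' : frame (Seq c (SetI x (INum 0) (IAdd (IVar x) (INum 1)))) s1 s' ->
    frame (For x c) s s'.
  by move=> h; apply: frame_trans f1 (frame_sub _ _ h) => a //= ->; rewrite orbT.
have nE s' : frame (For x c) s s' -> imem s' 0 0 = n.
  by move=> h; rewrite h.1 //= !negb_or c0 eq_sym x0.
apply: (@ends_while _ _ (fun k s' => [/\ (k <= n)%N, imem s' x 0 = k & Inv k s'])).
- by split=> //; [rewrite /s1 /= /upd !eqxx|exact: hstab].
- move=> k s' /fr hf [kn hk hI] /=; rewrite (nE _ hf) hk -ltnNge => kn'.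
  split; first exact: leq_trans kn' nN.
  apply/ends_seq/ends_frame/(ends_mono _ (hstep _ _ kn' hf hk hI)) => s2 hI2 f2.
  apply/ends_seti => /=; split=> //; last exact: hstab.
  by rewrite /upd eqxx /= f2.1 // hk addn1.
- move=> k s' /fr hf [kn hk hI] /=; rewrite (nE _ hf) hk negbK => nk.
  by apply: hend => //; have -> : n = k by apply/eqP; rewrite eqn_leq nk kn.
Qed.

(** * Critical speeds *)

Section CriticalSpeeds.
Variables (R : realType) (alpha : R) (n : nat) (m : R) (D W sz : nat -> R).
Hypotheses (alpha1 : 1 < alpha) (m0 : 0 < m).
Hypotheses (D0 : forall i, (i < n)%N -> 0 < D i)
  (W0 : forall i, (i < n)%N -> 0 < W i) (sz0 : forall i, (i < n)%N -> 0 < sz i).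
Implicit Types (v y : nat -> R).

(* A job is fixed once its speed is nonzero, so that unfixed jobs contribute
   [_ / 0 = 0] to [fixed_area]. *)
Definition fixed_area v k : R := \sum_(0 <= i < k) sz i * W i / v i.
Definition unfixed_work v k : R :=
  \sum_(0 <= i < k) if v i == 0 then sz i * W i else 0.

(** The constraints of the relaxation, by EDF position: [y i] stands for the processor time given to
    a job. *)
Definition capacity_ok y : Prop :=
  (forall k, (k < n)%N -> \sum_(0 <= i < k.+1) y i <= m * D k) /\
  (forall i, (i < n)%N -> y i <= sz i * D i).

(** The speed at which the unfixed jobs of the prefix exactly fill the area that the fixed ones
    leave. *)
Definition density v k : R := unfixed_work v k.+1 / (m * D k - fixed_area v k.+1).

(** [theta] is the largest candidate speed so far and [[lo, hi)] the positions forcing it: a single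
    job for a window, everything from 0 on for a prefix. The first alternative is the start of the
    scan. *)
Definition scan_inv v (k : nat) (theta : R) (lo hi : nat) : Prop :=
  [/\ 0 <= theta,
      forall i, (i < k)%N -> v i = 0 -> W i / D i <= theta,
      forall i, (i < k)%N -> density v i <= theta
    & [\/ theta = 0 /\ hi = 0%N,
          exists i, [/\ (i < k)%N, v i = 0, theta = W i / D i, lo = i & hi = i.+1]
        | exists i, [/\ (i < k)%N, theta = density v i, lo = 0%N & hi = i.+1]]].

Definition fix_range v theta (lo hi : nat) : nat -> R :=
  fun i => if (lo <= i < hi)%N && (v i == 0) then theta else v i.

(** [b] is the length of the last saturated prefix, and [theta] bounds all speeds still to come. Up
    to [b] all jobs are fixed and the area is full; beyond [b] jobs are fixed only by their own
    windows. The weights are relative to the level [theta], so that the sum can be updated as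
    [theta] falls. *)
Definition speed_inv (it : nat) v : Prop :=
  exists (b : nat) (theta : R),
  [/\ [/\ (b <= n)%N, 0 <= theta
         & forall i, (i < n)%N -> 0 <= v i /\ (v i != 0 -> W i / D i <= v i)],
      forall k, (k < n)%N ->
        unfixed_work v k.+1 <= theta * (m * D k - fixed_area v k.+1) /\
        0 <= m * D k - fixed_area v k.+1,
      [/\ forall i, (i < n)%N -> v i = 0 -> W i / D i <= theta,
          forall i, (i < b)%N -> v i != 0,
          b = 0%N \/ fixed_area v b = m * D b.-1
        & forall i, (b <= i < n)%N -> v i != 0 -> v i = W i / D i],
      forall y, capacity_ok y ->
        \sum_(0 <= i < n) (if v i == 0 then 0 else
          (v i `^ alpha - theta `^ alpha) * (y i - sz i * W i / v i)) <= 0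
    & (it <= \sum_(0 <= i < n) (v i != 0%R))%N].

Lemma job_area_gt0 i : (i < n)%N -> 0 < sz i * W i.
Proof. by move=> h; rewrite mulr_gt0 ?sz0 ?W0. Qed.

Lemma min_speed_gt0 i : (i < n)%N -> 0 < W i / D i.
Proof. by move=> h; rewrite divr_gt0 ?W0 ?D0. Qed.

Lemma unfixed_work_ge0 v k : (k <= n)%N -> 0 <= unfixed_work v k.
Proof.
move=> kn; rewrite /unfixed_work big_nat sumr_ge0 // => i /andP[_ ik].
by case: ifP => // _; apply/ltW/job_area_gt0/(leq_trans ik).
Qed.

Lemma speed_inv0 : speed_inv 0 (fun=> 0).
Proof.
(* Any value above all initial candidates serves; here it is their sum, with the total work in place
   of each prefix work. *)
pose theta := \sum_(0 <= i < n) (W i / D i + unfixed_work (fun=> 0) n / (m * D i)).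
have term i : (i < n)%N -> 0 <= unfixed_work (fun=> 0) n / (m * D i).
  by move=> h; rewrite divr_ge0 ?unfixed_work_ge0 // mulr_ge0 // ltW // D0.
have le_theta i : (i < n)%N -> W i / D i + unfixed_work (fun=> 0) n / (m * D i) <= theta.
  move=> h; rewrite /theta !big_mkord.
  rewrite (bigD1 (Ordinal h)) //= lerDl sumr_ge0 // => j _.
  by rewrite addr_ge0 ?term // ltW ?min_speed_gt0.
have fa k : fixed_area (fun=> 0) k = 0.
  by rewrite /fixed_area big1 // => i _; rewrite invr0 mulr0.
have theta0 : 0 <= theta.
  rewrite /theta big_nat sumr_ge0 // => i /andP[_ h].
  by rewrite addr_ge0 ?term // ltW ?min_speed_gt0.
exists 0%N, theta; split.
- by split=> // i _; split=> //; rewrite eqxx.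
- move=> k kn; rewrite fa subr0; split; last by rewrite mulr_ge0 // ltW // D0.
  have mD : 0 < m * D k by rewrite mulr_gt0 ?D0.
  rewrite -ler_pdivrMr //.
  apply: le_trans (le_theta _ kn); rewrite -[leLHS]add0r.
  apply: lerD; first exact/ltW/min_speed_gt0.
  rewrite ler_pM2r ?invr_gt0 // /unfixed_work [leRHS](big_cat_nat (n := k.+1)) //=.
  rewrite lerDl big_nat sumr_ge0 // => i /andP[_ h].
  by rewrite eqxx ltW // job_area_gt0.
- split=> //; last by move=> i _; rewrite eqxx.
    by move=> i h _; apply: le_trans (le_theta _ h); rewrite lerDl term.
  by left.
- by move=> y _; rewrite big1 // => i _; rewrite eqxx.
- by [].
Qed.

(** The saturated prefix uses all of [m * D b.-1], which [y] cannot exceed, and each fixed job after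
    it uses its whole window, [sz i * D i]. *)
Lemma fixed_slack v b y :
  (b <= n)%N -> (forall i, (i < b)%N -> v i != 0) ->
  b = 0%N \/ fixed_area v b = m * D b.-1 ->
  (forall i, (b <= i < n)%N -> v i != 0 -> v i = W i / D i) ->
  capacity_ok y ->
  \sum_(0 <= i < n) (if v i == 0 then 0 else y i - sz i * W i / v i) <= 0.
Proof.
move=> bn hb tight tail [yp y1].
rewrite (big_cat_nat (n := b)) //= -[leRHS]addr0; apply: lerD; last first.
  rewrite big_nat sumr_le0 // => i /andP[bi iN].
  case: ifPn => // vi; rewrite tail ?bi // subr_le0.
  apply: le_trans (y1 _ iN) _; rewrite invf_div.
  have := W0 iN; have := D0 iN => d0 w0.
  by rewrite mulrA -(mulrA (sz i)) (mulrC (W i)) mulrA mulfK // gt_eqF.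
have -> : \sum_(0 <= i < b) (if v i == 0 then 0 else y i - sz i * W i / v i) =
    \sum_(0 <= i < b) y i - fixed_area v b.
  rewrite /fixed_area -sumrB; apply: eq_big_nat => i /andP[_ ib].
  by rewrite (negbTE (hb _ ib)).
rewrite subr_le0; case: tight => [->|E]; first by rewrite /fixed_area !big_geq.
case: b bn hb tail E => [|b] bn hb tail E; first by rewrite /fixed_area !big_geq.
by rewrite E; apply: yp.
Qed.

Lemma speed_inv_step it v theta lo hi : (it < n)%N ->
  speed_inv it v -> scan_inv v n theta lo hi ->
  speed_inv it.+1 (fix_range v theta lo hi).
Proof.
move=> itn [b [th [[bn th0 vpos] cap [unf fixb tight tail] dual cnt]]].
move=> [t0 tdelta tdens tcase].
(* If no job is left to fix, the round changes nothing, and the count is already [n]. *)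
case: (pselect (exists2 i, (i < n)%N & v i = 0)) => [[i0 i0n vi0]|allfixed]; last first.
  have nz i : (i < n)%N -> v i != 0.
    by move=> h; apply/eqP => hv; apply: allfixed; exists i.
  have E i : fix_range v theta lo hi i = if (i < n)%N then v i else
      fix_range v theta lo hi i.
    case: ifP => // h; rewrite /fix_range (negbTE (nz _ h)) andbF //.
  have Ei i : (i < n)%N -> fix_range v theta lo hi i = v i by move=> h; rewrite E h.
  have EX k : (k <= n)%N -> fixed_area (fix_range v theta lo hi) k = fixed_area v k.
    move=> kn; apply: eq_big_nat => i /andP[_ ik]; rewrite Ei //; exact: leq_trans kn.
  have EU k : (k <= n)%N -> unfixed_work (fix_range v theta lo hi) k = unfixed_work v k.
    move=> kn; apply: eq_big_nat => i /andP[_ ik]; rewrite Ei //; exact: leq_trans kn.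
  exists b, th; split.
  - by split=> // i h; rewrite Ei //; apply: vpos.
  - by move=> k kn; rewrite EX ?EU //; apply: cap.
  - split.
    + by move=> i h; rewrite Ei //; apply: unf.
    + by move=> i h; rewrite Ei ?(leq_trans h) //; apply: fixb.
    + by case: tight; [left|right; rewrite EX].
    + by move=> i /andP[h1 h2]; rewrite Ei //; apply: tail; rewrite h1.
  - move=> y hy; rewrite (eq_big_nat _ _ (F2 := fun i => if v i == 0 then 0 else
          (v i `^ alpha - th `^ alpha) * (y i - sz i * W i / v i))) ?dual //.
    by move=> i /andP[_ h]; rewrite Ei.
  - rewrite (eq_big_nat _ _ (F2 := fun=> 1%N)) ?sum_nat_const_nat ?muln1 ?subn0 //.
    by move=> i /andP[_ h]; rewrite Ei // nz.
have tpos : 0 < theta by apply: lt_le_trans (min_speed_gt0 i0n) (tdelta _ i0n vi0).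
set v' := fix_range v theta lo hi.
pose new i := (lo <= i < hi)%N && (v i == 0).
have v'E i : v' i = if new i then theta else v i by [].
(* The work fixed in this round: it leaves the unfixed work and adds [N k / theta] to the fixed
   area. *)
pose N k : R := \sum_(0 <= i < k) if new i then sz i * W i else 0.
have EU k : unfixed_work v' k = unfixed_work v k - N k.
  rewrite /unfixed_work /N -sumrB; apply: eq_bigr => i _; rewrite v'E /new.
  by case: (_ <= _ < _)%N => /=; case: (eqVneq (v i) 0) => /=;
    rewrite ?(gt_eqF tpos) ?subrr ?subr0 // => /negbTE->.
have EX k : fixed_area v' k = fixed_area v k + N k / theta.
  rewrite /fixed_area /N mulr_suml -big_split; apply: eq_bigr => i _; rewrite v'E /new.
  by case: (_ <= _ < _)%N => /=; case: (eqVneq (v i) 0) => [->|_] /=;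
    rewrite ?invr0 ?mulr0 ?mul0r ?add0r ?addr0.
(* Where no area is left, the density is [_ / 0 = 0]; there [cap] bounds the unfixed work by 0. *)
have dens_le k : (k < n)%N ->
    unfixed_work v k.+1 <= theta * (m * D k - fixed_area v k.+1).
  move=> kn; have [c1 c2] := cap _ kn; have := tdens _ kn; rewrite /density.
  move: c2; rewrite le_eqVlt => /predU1P[h|h].
    by move: c1; rewrite -h !mulr0.
  by rewrite ler_pdivrMr.
have new0 i : new i -> v i = 0 by move=> /andP[_ /eqP].
have hin i : (i < hi)%N -> (i < n)%N.
  case: tcase => [[e _]|[j [jn _ _ _ ->]]|[j [jn _ _ ->]]] ij.
  - by rewrite e ltxx in tpos.
  - exact: leq_trans ij jn.
  - exact: leq_trans ij jn.
have newn i : new i -> (i < n)%N by move=> /andP[/andP[_ /hin]].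
have th_le : theta <= th.
  case: tcase => [[-> _]//|[j [jn vj -> _ _]]|[j [jn tE _ _]]]; first exact: unf.
  have [c1 c2] := cap _ jn.
  have r0 : m * D j - fixed_area v j.+1 != 0.
    by apply: contraTneq tpos => r0; rewrite tE /density r0 invr0 mulr0 ltxx.
  have rp : 0 < m * D j - fixed_area v j.+1 by rewrite lt_def r0.
  by rewrite tE /density ler_pdivrMr.
(* Both sides of the first inequality drop by [N k.+1]. The area left stays nonnegative because the
   unfixed work is, and [theta > 0]. *)
have cap' k : (k < n)%N ->
    unfixed_work v' k.+1 <= theta * (m * D k - fixed_area v' k.+1) /\
    0 <= m * D k - fixed_area v' k.+1.
  move=> kn.
  have h : unfixed_work v' k.+1 <= theta * (m * D k - fixed_area v' k.+1).
    have -> : theta * (m * D k - fixed_area v' k.+1) =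
        theta * (m * D k - fixed_area v k.+1) - N k.+1.
      by rewrite EX; field; rewrite gt_eqF.
    by rewrite EU lerD2r dens_le.
  split=> //; rewrite -(pmulr_rge0 _ tpos); apply: le_trans h.
  exact: unfixed_work_ge0.
(* Abel summation: lowering the level from [th] to [theta] adds the difference of their powers times
   the slack of [fixed_slack], and the newly fixed jobs enter with weight 0. *)
have dual' y : capacity_ok y -> \sum_(0 <= i < n) (if v' i == 0 then 0 else
          (v' i `^ alpha - theta `^ alpha) * (y i - sz i * W i / v' i)) <= 0.
  move=> hy; have d1 := dual _ hy; have d2 := fixed_slack bn fixb tight tail hy.
  have pw : theta `^ alpha <= th `^ alpha.
    apply: ge0_ler_powR; rewrite ?nnegrE //; exact: le_trans ler01 (ltW alpha1).
  have -> : \sum_(0 <= i < n) (if v' i == 0 then 0 else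
          (v' i `^ alpha - theta `^ alpha) * (y i - sz i * W i / v' i)) =
    \sum_(0 <= i < n) (if v i == 0 then 0 else
          (v i `^ alpha - th `^ alpha) * (y i - sz i * W i / v i)) +
    (th `^ alpha - theta `^ alpha) *
     \sum_(0 <= i < n) (if v i == 0 then 0 else y i - sz i * W i / v i).
    rewrite mulr_sumr -big_split; apply: eq_bigr => i _ /=; rewrite v'E.
    case: (boolP (new i)) => [/new0 ->|_]; first by rewrite eqxx (gt_eqF tpos) subrr mul0r mulr0 addr0.
    by case: ifPn => _; [rewrite mulr0 addr0|ring].
  by rewrite -[leRHS]addr0 lerD // mulr_ge0_le0 // subr_ge0.
(* The round fixes some job: the one with the critical window, or, as [theta > 0], an unfixed one in
   the critical prefix. *)
have cnt' : (it < \sum_(0 <= i < n) (v' i != 0%R))%N.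
  have [i ni] : exists i, new i.
    case: tcase => [[e _]|[j [jn vj _ lE hE]]|[j [jn tE lE hE]]].
    - by rewrite e ltxx in tpos.
    - by exists j; rewrite /new vj eqxx lE hE leqnn ltnS leqnn.
    - apply: contrapT => /forallNP none; move: tpos.
      suff -> : theta = 0 by rewrite ltxx.
      rewrite tE /density /unfixed_work big_nat big1 ?mul0r // => i ij.
      by have /negP := none i; rewrite /new lE hE ij /= => /negbTE ->.
  have iN := newn _ ni; have vi := new0 _ ni.
  apply: leq_ltn_trans cnt _; rewrite !big_mkord.
  rewrite (bigD1 (Ordinal iN)) //= [ltnRHS](bigD1 (Ordinal iN)) //=.
  rewrite vi eqxx add0n v'E ni gt_eqF //= add1n ltnS; apply: leq_sum => j _.
  rewrite v'E; case: ifP => // _; rewrite (gt_eqF tpos) /=; by case: (_ != _).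
have vpos' i : (i < n)%N -> 0 <= v' i /\ (v' i != 0 -> W i / D i <= v' i).
  move=> h; rewrite v'E; case: ifPn => [ni|_]; last exact: vpos.
  by split=> // _; apply: tdelta => //; apply: new0.
have unf' i : (i < n)%N -> v' i = 0 -> W i / D i <= theta.
  move=> h; rewrite v'E; case: ifPn => [_ e|_]; first by rewrite e ltxx in tpos.
  exact: tdelta.
case: tcase => [[e _]|[j [jn vj tE lE hE]]|[j [jn tE lE hE]]].
- by rewrite e ltxx in tpos.
(* Critical window: only [j] is new, and being unfixed it lies outside the saturated prefix, which
   is kept. *)
- have newE i : new i = (i == j).
    rewrite /new lE hE ltnS -eqn_leq eq_sym.
    by case: eqVneq => [->|]; rewrite ?vj ?eqxx.
  have bj : (b <= j)%N by rewrite leqNgt; apply/negP => /fixb; rewrite vj eqxx.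
  exists b, theta; split=> //; split=> //.
  + move=> i ib; rewrite v'E newE; have -> : (i == j) = false by lia.
    exact: fixb.
  + case: tight => [|tight]; [by left|right].
    rewrite -tight; apply: eq_big_nat => i /andP[_ ib].
    by rewrite v'E newE; have -> : (i == j) = false by lia.
  + move=> i ib; rewrite v'E newE; case: (eqVneq i j) => [->|_] //; exact: tail.
(* Critical prefix: its new jobs take exactly the area left, so it becomes the saturated one. *)
- have newE i : new i = (i <= j)%N && (v i == 0) by rewrite /new lE hE ltnS.
  have NU : N j.+1 = unfixed_work v j.+1.
    by apply: eq_big_nat => i /andP[_ ij]; rewrite newE -ltnS ij.
  have Upos : unfixed_work v j.+1 != 0.
    by apply: contraTneq tpos => h; rewrite tE /density h mul0r ltxx.
  have r0 : m * D j - fixed_area v j.+1 != 0.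
    by apply: contraTneq tpos => r0; rewrite tE /density r0 invr0 mulr0 ltxx.
  have bj : (b <= j.+1)%N.
    rewrite leqNgt; apply/negP => jb; move/eqP: Upos; apply.
    rewrite /unfixed_work big_nat big1 // => i /andP[_ ij].
    by rewrite ifN // fixb //; lia.
  exists j.+1, theta; split=> //; split=> //.
  + move=> i ij; rewrite v'E newE -ltnS ij /=.
    by case: ifPn => // _; rewrite gt_eqF.
  + right; rewrite EX NU tE /density /=; field.
    by rewrite r0 Upos.
  + move=> i /andP[ji iN]; rewrite v'E newE ifN; last lia.
    by apply: tail; rewrite iN andbT; lia.
Qed.

(** By the count, [n] rounds leave no job unfixed. The weight [v i ^ alpha] is the weight of the
    invariant plus a constant, whose share is controlled by [fixed_slack]. *)
Lemma speed_inv_final v : speed_inv n v ->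
  [/\ forall i, (i < n)%N -> 0 < v i /\ W i / D i <= v i,
      forall k, (k < n)%N -> \sum_(0 <= i < k.+1) sz i * W i / v i <= m * D k
    & forall y, capacity_ok y ->
        \sum_(0 <= i < n) v i `^ alpha * (y i - sz i * W i / v i) <= 0].
Proof.
move=> [b [th [[bn th0 vpos] cap [unf fixb tight tail] dual cnt]]].
have nz i : (i < n)%N -> v i != 0.
  move=> h; apply/negP => vi; move: cnt.
  rewrite big_mkord (bigD1 (Ordinal h)) //= vi add0n leqNgt => /negP; apply.
  apply: (@leq_ltn_trans (\sum_(j < n | j != Ordinal h) 1)).
    by apply: leq_sum => j _; case: (_ != _).
  rewrite sum1_card -(@ltn_add2l 1) add1n.
  have := cardC1 (Ordinal h); rewrite card_ord => E.
  by rewrite (@eq_card _ _ (predC1 (Ordinal h))) // E; lia.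
split.
- by move=> i h; have [h1 h2] := vpos _ h; rewrite lt_def h1 nz //= h2 ?nz.
- by move=> k kn; have [_] := cap _ kn; rewrite subr_ge0.
- move=> y hy; have d1 := dual _ hy; have d2 := fixed_slack bn fixb tight tail hy.
  have -> : \sum_(0 <= i < n) v i `^ alpha * (y i - sz i * W i / v i) =
    \sum_(0 <= i < n) (if v i == 0 then 0 else
          (v i `^ alpha - th `^ alpha) * (y i - sz i * W i / v i)) +
    th `^ alpha *
     \sum_(0 <= i < n) (if v i == 0 then 0 else y i - sz i * W i / v i).
    rewrite mulr_sumr -big_split; apply: eq_big_nat => i /andP[_ h] /=.
    by rewrite (negbTE (nz _ h)); ring.
  by rewrite -[leRHS]addr0 lerD // mulr_ge0_le0 // powR_ge0.
Qed.

End CriticalSpeeds.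

(** * List scheduling *)

Section ListScheduling.
Variable R : realType.

(* A block [(lo, hi, e)] consists of the processors of [lo, hi), all of them
   available from time [e] on. *)
Definition block : Type := (nat * nat * R)%type.
Implicit Types (b : block) (l : seq block) (S T P A : R).

Definition members b : seq nat := index_iota b.1.1 b.1.2.
Definition procs_of l : seq nat := flatten [seq members b | b <- l].

Definition residual l T : R := \sum_(b <- l) (size (members b))%:R * (b.2 - T).

(* [T] is the last start time and [A] the total area of the scheduled jobs: more
   than half of the processors have been busy up to [T], and [residual l T] is
   the area used after [T]. *)
Definition blocks_inv (m : nat) l T A : Prop :=
  [/\ perm_eq (procs_of l) (iota 0 m),
      pairwise (fun b b' => b.2 <= b'.2) l,
      forall b, b \in l -> T <= b.2,
      0 <= T
    & (m%:R + 1) / 2 * T + residual l T <= A].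

Lemma procs_of_cat l1 l2 : procs_of (l1 ++ l2) = procs_of l1 ++ procs_of l2.
Proof. by rewrite /procs_of map_cat flatten_cat. Qed.

Lemma procs_of_cons b l : procs_of (b :: l) = members b ++ procs_of l.
Proof. by []. Qed.

Lemma mem_procs_of l p :
  reflect (exists2 b, b \in l & p \in members b) (p \in procs_of l).
Proof. exact: flatten_mapP. Qed.

Lemma procs_of_relabel (e : R) l : procs_of [seq (b.1, e) | b <- l] = procs_of l.
Proof. by rewrite /procs_of -map_comp. Qed.

Lemma residual_cat l1 l2 T : residual (l1 ++ l2) T = residual l1 T + residual l2 T.
Proof. exact: big_cat. Qed.

Lemma residual_cons b l T :
  residual (b :: l) T = (size (members b))%:R * (b.2 - T) + residual l T.
Proof. exact: big_cons. Qed.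

Lemma residual_shift l S T :
  residual l T = residual l S + (size (procs_of l))%:R * (S - T).
Proof.
elim: l => [|b l IH]; first by rewrite /residual !big_nil mul0r addr0.
rewrite !residual_cons IH procs_of_cons size_cat natrD; ring.
Qed.

Lemma residual_ge0 l T : (forall b, b \in l -> T <= b.2) -> 0 <= residual l T.
Proof.
move=> h; rewrite /residual big_seq sumr_ge0 // => b /h bT.
by rewrite mulr_ge0 // subr_ge0.
Qed.

Lemma residual_relabel l e T :
  residual [seq (b.1, e) | b <- l] T = (size (procs_of l))%:R * (e - T).
Proof.
elim: l => [|b l IH]; first by rewrite /residual big_nil mul0r.
rewrite map_cons residual_cons IH procs_of_cons size_cat natrD /members /=; ring.
Qed.

Lemma blocks_inv0 m : blocks_inv m [:: (0%N, m, 0)] 0 0.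
Proof.
split=> //.
- by rewrite procs_of_cons cats0 /members /index_iota /= subn0.
- by move=> b; rewrite inE => /eqP->.
- by rewrite residual_cons /residual big_nil subr0 !mulr0 !addr0.
Qed.

(** * Effect of one job on the list of blocks *)

Section Step.
Variables (m s : nat) (L M1 M2 : seq block) (lo hi q : nat) (S T P A : R).
(** The job takes all of [L] and [q] processors of the block available at [S]. The taken blocks, now
    available at [S + P], go between [M1] and [M2], which keeps the list sorted; the remainder of
    the split block, possibly empty, goes first. *)
Let l := L ++ (lo, hi, S) :: M1 ++ M2.
Let taken := [seq (b.1, S + P) | b <- rcons L (lo, (lo + q)%N, S)].
Let l' := ((lo + q)%N, hi, S) :: M1 ++ taken ++ M2.
Hypotheses (inv : blocks_inv m l T A) (q0 : (0 < q)%N) (qhi : (lo + q <= hi)%N)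
  (sE : (size (procs_of L) + q)%N = s) (sm : (s.*2 <= m)%N) (P0 : 0 <= P)
  (hM1 : forall b, b \in M1 -> b.2 <= S + P)
  (hM2 : forall b M, M2 = b :: M -> S + P <= b.2).

Let members_splitE (e e' e'' : R) :
  members (lo, hi, e) = members (lo, (lo + q)%N, e') ++ members ((lo + q)%N, hi, e'').
Proof.
rewrite /members /index_iota /=.
have -> : (hi - lo = (lo + q - lo) + (hi - (lo + q)))%N by lia.
by rewrite iotaD; congr (_ ++ iota _ _); lia.
Qed.

Let takenE : procs_of taken = procs_of L ++ members (lo, (lo + q)%N, S).
Proof. by rewrite procs_of_relabel -cats1 procs_of_cat procs_of_cons cats0. Qed.

Let perm_step : perm_eq (procs_of l') (procs_of l).
Proof.
rewrite /l' /l procs_of_cons !procs_of_cat procs_of_cons procs_of_cat takenE.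
rewrite (members_splitE S S S); apply/permP => a; rewrite !count_cat; lia.
Qed.

Let M2_late b : b \in M2 -> S + P <= b.2.
Proof.
case E : M2 => [//|b0 M]; rewrite inE => /predU1P[->|bM]; first exact: hM2 E.
have [_ + _ _ _] := inv; rewrite /l E pairwise_cat pairwise_cons pairwise_cat.
rewrite pairwise_cons => /and3P[_ _ /andP[_ /and3P[_ _ /andP[/allP h _]]]].
exact: le_trans (hM2 E) (h _ bM).
Qed.

Let rest_late b : b \in M1 ++ M2 -> S <= b.2.
Proof.
have [_ + _ _ _] := inv; rewrite /l pairwise_cat pairwise_cons.
by move=> /and3P[_ _ /andP[/allP h _]] /h.
Qed.

Let first_early b : b \in L -> b.2 <= S.
Proof.
have [_ + _ _ _] := inv; rewrite /l pairwise_cat => /and3P[/allrelP h _ _] bL.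
by apply: (h b (lo, hi, S)); rewrite ?inE ?eqxx.
Qed.

Lemma taken_size : size (procs_of taken) = s.
Proof. by rewrite takenE size_cat size_iota -sE /= addKn. Qed.

Let uniq_l' : uniq (procs_of l').
Proof. by rewrite (perm_uniq perm_step); have [/perm_uniq-> _ _ _ _] := inv; exact: iota_uniq. Qed.

Lemma taken_uniq : uniq (procs_of taken).
Proof.
move: uniq_l'; rewrite /l' procs_of_cons !procs_of_cat !cat_uniq.
by move=> /and3P[_ _ /and3P[_ _ /and3P[]]].
Qed.

Lemma taken_lt p : p \in procs_of taken -> (p < m)%N.
Proof.
move=> hp; have : p \in procs_of l'.
  by rewrite /l' procs_of_cons !procs_of_cat !mem_cat hp !orbT.
rewrite (perm_mem perm_step); have [/perm_mem-> _ _ _ _] := inv.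
by rewrite mem_iota add0n.
Qed.

Lemma start_ge : T <= S.
Proof.
by have [_ _ h _ _] := inv; apply: (h (lo, hi, S)); rewrite mem_cat inE eqxx orbT.
Qed.

(** The processors outside [L] are busy from [T] to [S]. Fewer than [s <= m / 2] processors lie in
    [L], so these are at least [(m + 1) / 2], and [residual_shift] extracts their area from
    [residual l T]. *)
Let area_step :
  (m%:R + 1) / 2 * S + (residual [:: ((lo + q)%N, hi, S)] S + residual (M1 ++ M2) S) <= A.
Proof.
have [/perm_size szl _ hT T0 hA] := inv.
have TS := start_ge.
move: szl; rewrite size_iota /l procs_of_cat procs_of_cons !size_cat => szl.
apply: le_trans hA.
rewrite /l (residual_cat L) (residual_cons _ _ T) (residual_shift (M1 ++ M2) S T).
have rL : 0 <= residual L T.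
  by apply: residual_ge0 => b bL; apply: hT; rewrite mem_cat bL.
have r1 : residual [:: ((lo + q)%N, hi, S)] S = 0.
  by rewrite residual_cons /residual big_nil subrr mulr0 addr0.
rewrite r1 add0r /=.
set a := size (members (lo, hi, S)) in szl *.
set c := size (procs_of (M1 ++ M2)) in szl *.
have ac : (m + 1 <= (a + c).*2)%N.
  move: szl q0 sE sm; clearbody a c; rewrite -!muln2; set z := size (procs_of L) => *; lia.
have {}ac : (m%:R + 1) / 2 <= a%:R + c%:R :> R.
  by rewrite ler_pdivrMr // natr1 -natrD -natrM ler_nat; lia.
have : 0 <= (a%:R + c%:R - (m%:R + 1) / 2) * (S - T) by rewrite mulr_ge0 // subr_ge0.
lra.
Qed.

Lemma start_area : (m%:R + 1) / 2 * S <= A.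
Proof.
apply: le_trans area_step; rewrite lerDl addr_ge0 // residual_ge0 //.
by move=> b; rewrite inE => /eqP->.
Qed.

Lemma blocks_inv_step : blocks_inv m l' S (A + s%:R * P).
Proof.
have [perm_l srt hT T0 hA] := inv.
have SP : S <= S + P by rewrite lerDl.
have taken_end b : b \in taken -> b.2 = S + P by case/mapP=> b0 _ ->.
split.
- exact: perm_trans perm_step perm_l.
- rewrite pairwise_cons; apply/andP; split.
    apply/allP => b; rewrite !mem_cat => /or3P[h|/taken_end->//|h].
      by apply: rest_late; rewrite mem_cat h.
    by apply: rest_late; rewrite mem_cat h orbT.
  move: srt; rewrite /l pairwise_cat pairwise_cons pairwise_cat.
  move=> /and3P[_ _ /andP[_ /and3P[_ sM1 sM2]]].
  rewrite !pairwise_cat sM1 sM2 /=; apply/and3P; split=> //.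
    apply/allrelP => b b' /hM1 h1; rewrite mem_cat => /orP[/taken_end->//|/M2_late].
    exact: le_trans.
    by apply/allrelP => b b' /taken_end -> /M2_late.
  rewrite andbT /taken pairwise_map; elim: (rcons L _) => //= b k ->.
  by rewrite ?andbT; apply/allP => b0 _ /=; exact: lexx.
- move=> b; rewrite inE => /predU1P[->//|]; rewrite !mem_cat => /or3P[h|/taken_end->//|h].
    by apply: rest_late; rewrite mem_cat h.
  by apply: rest_late; rewrite mem_cat h orbT.
- exact: le_trans T0 start_ge.
(* Relative to [S], the taken blocks are worth [s * P], the area of the new job. *)
- have -> : residual l' S = residual [:: ((lo + q)%N, hi, S)] S + residual (M1 ++ M2) S
      + s%:R * P.
    rewrite /l' -cat1s !residual_cat residual_relabel -(procs_of_relabel (S + P)).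
    rewrite -/taken taken_size; ring.
  by rewrite addrA lerD2r area_step.
Qed.

(** Read [e] as the end of an earlier job on processor [p]: the time from which a processor is
    available never decreases. *)
Lemma ends_preserved (e : R) p :
  (forall b, b \in l -> p \in members b -> e <= b.2) ->
  forall b, b \in l' -> p \in members b -> e <= b.2.
Proof.
move=> h b; rewrite inE => /predU1P[->|].
  move=> hp; apply: (h (lo, hi, S)); first by rewrite mem_cat inE eqxx orbT.
  by rewrite (members_splitE S S S) mem_cat hp orbT.
rewrite !mem_cat => /or3P[hb|/mapP[b0 + ->]|hb].
- by apply: h; rewrite mem_cat inE mem_cat hb !orbT.
- rewrite mem_rcons inE => /predU1P[->|hb] hp; last first.
    have e0 : e <= b0.2 by apply: h => //; rewrite mem_cat hb.
    apply: le_trans e0 (le_trans (first_early hb) _); by rewrite lerDl.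
  have e0 : e <= S.
    apply: (h (lo, hi, S)); first by rewrite mem_cat inE eqxx orbT.
    by rewrite (members_splitE S S S) mem_cat hp.
  by apply: le_trans e0 _; rewrite lerDl.
- by apply: h; rewrite mem_cat inE mem_cat hb !orbT.
Qed.

Lemma taken_available (e : R) p :
  (forall b, b \in l -> p \in members b -> e <= b.2) ->
  p \in procs_of taken -> e <= S.
Proof.
move=> h; rewrite takenE mem_cat => /orP[/mem_procs_of[b bL pb]|hp].
  by apply: le_trans (first_early bL); apply: h => //; rewrite mem_cat bL.
apply: (h (lo, hi, S)); first by rewrite mem_cat inE eqxx orbT.
by rewrite (members_splitE S S S) mem_cat hp.
Qed.

(** By uniqueness a taken processor is neither in the remainder nor in [M1]; all other blocks are
    available at [S + P] at the earliest. *)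
Lemma taken_end p : p \in procs_of taken ->
  forall b, b \in l' -> p \in members b -> S + P <= b.2.
Proof.
move=> hp b bl' pb; move: uniq_l'.
rewrite /l' procs_of_cons !procs_of_cat !cat_uniq.
move=> /and3P[_ /hasPn h1 /and3P[_ /hasPn h2 _]].
have pt : p \in procs_of taken ++ procs_of M2 by rewrite mem_cat hp.
move: bl'; rewrite inE => /predU1P[bE|].
  have /negP[] : p \notin members ((lo + q)%N, hi, S) by apply: h1; rewrite mem_cat pt orbT.
  by rewrite -bE.
rewrite !mem_cat => /or3P[hb|/mapP[b0 _ ->//]|/M2_late//].
by have /negP[] := h2 _ pt; apply/mem_procs_of; exists b.
Qed.

End Step.

(** The constant is chosen for this balance. With [d = D / c] and [c = (3 m - 1) / (m + 1)], the
    quantity [(m + 1) / 2 * (S + P)] is at most [A + P + (m - 1) / 2 * P], hence at most [m * d + (m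
    - 1) / 2 * d = (m + 1) / 2 * D]. *)
Lemma list_schedule_in_time (m s : nat) (S P A D : R) :
  (0 < m)%N -> (0 < s)%N -> 0 <= P ->
  (m%:R + 1) / 2 * S <= A ->
  A + s%:R * P <= m%:R * D / (3 - 4 / (m%:R + 1)) ->
  P <= D / (3 - 4 / (m%:R + 1)) ->
  S + P <= D.
Proof.
move=> m0 s0 P0 hS hA hP.
have m1 : 1 <= m%:R :> R by rewrite ler1n.
have s1 : 1 <= s%:R :> R by rewrite ler1n.
have cE : 3 - 4 / (m%:R + 1) = (3 * m%:R - 1) / (m%:R + 1) :> R.
  by field; lra.
rewrite cE in hA hP.
have k0 : 0 < 3 * m%:R - 1 :> R by lra.
have m10 : 0 < m%:R + 1 :> R by lra.
pose d := D / ((3 * m%:R - 1) / (m%:R + 1)).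
have dE : D * (m%:R + 1) = d * (3 * m%:R - 1).
  by rewrite /d; field; rewrite !gt_eqF.
have hA' : A + s%:R * P <= m%:R * d by rewrite /d mulrA.
have hP' : P <= d by [].
have sP : P <= s%:R * P by rewrite ler_peMl.
have h : (m%:R + 1) / 2 * (S + P) <= (m%:R + 1) / 2 * D.
  have : (m%:R - 1) * P <= (m%:R - 1) * d by rewrite ler_wpM2l // subr_ge0.
  nra.
by move: h; rewrite ler_pM2l // divr_gt0.
Qed.

End ListScheduling.

(** * The program *)

Section EarliestDeadlineFirst.
Variables (R : realType) (n : nat) (D : nat -> R).

(** The strict lexicographic order on window length and index, built from the comparisons that
    programs can evaluate. *)
Definition before (j i : nat) : bool := (D j <= D i) && ~~ ((D i <= D j) && (i <= j)%N).
Definition rank (i : nat) : nat := count (before ^~ i) (iota 0 n).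

Lemma before_irr i : before i i = false.
Proof. by rewrite /before lexx leqnn. Qed.

Lemma before_trans : transitive before.
Proof.
move=> j i k /andP[h1 h2] /andP[h3 h4]; apply/andP; split.
  exact: le_trans h1 h3.
apply: contra h2 => /andP[ki kj]; move: h4; rewrite (le_trans ki h1) /= -ltnNge => jk.
by rewrite (le_trans h3 ki) /=; apply: leq_trans kj; apply: ltnW.
Qed.

Lemma before_total i j : i != j -> before i j || before j i.
Proof.
rewrite /before neq_ltn; case: (ltgtP (D i) (D j)) => //= _.
by rewrite -!ltnNge => /orP[->|->]; rewrite ?orbT.
Qed.

Lemma rank_lt_n i : (i < n)%N -> (rank i < n)%N.
Proof.
move=> ilt; rewrite /rank -[X in (_ < X)%N](size_iota 0).
rewrite ltn_neqAle count_size andbT -all_count; apply/negP => /allP /(_ i).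
by rewrite mem_iota add0n ilt before_irr => /(_ isT).
Qed.

Lemma rank_mono i j : (i < n)%N -> before i j -> (rank i < rank j)%N.
Proof.
move=> ilt ij; rewrite /rank.
have ei : (count (before ^~ i) (iota 0 n) + count (pred1 i) (iota 0 n) =
    count (predU (before ^~ i) (pred1 i)) (iota 0 n))%N.
  rewrite -count_predUI -[RHS]addn0; congr addn; apply/eqP.
  rewrite -leqn0 leqNgt -has_count; apply/hasPn => k _ /=.
  by case: (eqVneq k i) => [->|]; rewrite ?before_irr ?andbF.
have c1 : count (pred1 i) (iota 0 n) = 1%N.
  by rewrite count_uniq_mem ?iota_uniq // mem_iota add0n ilt.
rewrite -addn1 -c1 ei; apply: sub_count => k /= /orP[ki|/eqP->//].
exact: before_trans ki ij.
Qed.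

Lemma rank_inj i j : (i < n)%N -> (j < n)%N -> rank i = rank j -> i = j.
Proof.
move=> hi hj E; apply/eqP; apply: contraT => /before_total /orP[] /rank_mono.
  by move=> /(_ hi); rewrite E ltnn.
by move=> /(_ hj); rewrite E ltnn.
Qed.

Definition sorting (pi : nat -> nat) : Prop :=
  [/\ forall k, (k < n)%N -> (pi k < n)%N,
      forall k l, (k < n)%N -> (l < n)%N -> pi k = pi l -> k = l,
      forall j, (j < n)%N -> exists2 k, (k < n)%N & pi k = j
    & forall k l, (k <= l)%N -> (l < n)%N -> D (pi k) <= D (pi l)].

(** [rank] is injective on [[0, n)], hence a bijection, and [pi] is its inverse there; the order
    comes from [rank_mono]. *)
Lemma rank_sorting (pi : nat -> nat) :
  (forall i, (i < n)%N -> pi (rank i) = i) -> sorting pi.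
Proof.
move=> hpi.
pose f (i : 'I_n) : 'I_n := Ordinal (rank_lt_n (ltn_ord i)).
have f_inj : injective f.
  by move=> i j /(congr1 val) /= E; apply/val_inj/(rank_inj (ltn_ord i) (ltn_ord j) E).
have [g _ fg] := injF_bij f_inj.
have key k : (k < n)%N -> (pi k < n)%N /\ rank (pi k) = k.
  move=> hk; have /(congr1 val) /= E := fg (Ordinal hk).
  by rewrite -E hpi.
split.
- by move=> k /key[].
- by move=> k l /key[_ ek] /key[_ el] E; rewrite -ek -el E.
- by move=> j jn; exists (rank j); rewrite ?rank_lt_n ?hpi.
- move=> k l kl ln; have kn := leq_ltn_trans kl ln.
  rewrite leNgt; apply/negP => lt.
  have [hk ek] := key _ kn; have [hl el] := key _ ln.
  have /(rank_mono hl) : before (pi l) (pi k) by rewrite /before ltW // leNgt lt.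
  by rewrite ek el ltnNge kl.
Qed.

End EarliestDeadlineFirst.

Notation inc x := (SetI x (INum 0) (IAdd (IVar x) (INum 1))).
Notation seti x e := (SetI x (INum 0) e).
Notation setr x e := (SetR x (INum 0) e).

(* Besides the input and output arrays, integer array 7 lists the jobs in EDF
   order, real arrays 5 and 7 hold the speeds before scaling and the window
   lengths, and the other arrays used below hold scalar variables. *)
Definition windows_cmd : cmd :=
  For 10 (SetR 7 (IVar 10) (RSub (RGet 1 (IVar 10)) (RGet 0 (IVar 10)))).

Definition before_test (j i : iexp) : bexp :=
  BAnd (BLeR (RGet 7 j) (RGet 7 i))
    (BNot (BAnd (BLeR (RGet 7 i) (RGet 7 j)) (BLeI i j))).

Definition ranks_cmd : cmd :=
  For 10 (Seq (seti 12 (INum 0))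
    (Seq (For 11 (If (before_test (IVar 11) (IVar 10)) (inc 12) Skip))
      (SetI 7 (IVar 12) (IVar 10)))).

Definition area_exp : rexp :=
  RMul (ROfInt (IGet 2 (IVar 13))) (RGet 2 (IVar 13)).

(** A running maximum: the candidate is real variable 13, the maximum real variable 8, and the range
    forcing it is kept in integer variables 14 and 15. *)
Definition raise_cmd (lo : iexp) : cmd :=
  If (BLeR (RVar 13) (RVar 8)) Skip
    (Seq (setr 8 (RVar 13))
      (Seq (seti 14 lo) (seti 15 (IAdd (IVar 11) (INum 1))))).

(** Real variables 9 and 10 accumulate the unfixed work and the fixed area of the prefix, so one
    pass yields all densities and a round takes linear time. An unfixed job has speed 0: dividing by
    it adds 0, and the test [<= 0] recognizes it. *)
Definition scan_cmd : cmd :=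
  Seq (seti 13 (IGet 7 (IVar 11)))
  (Seq (setr 10 (RAdd (RVar 10) (RDiv area_exp (RGet 5 (IVar 13)))))
  (Seq (If (BLeR (RGet 5 (IVar 13)) (ROfInt (INum 0)))
    (Seq (setr 9 (RAdd (RVar 9) area_exp))
    (Seq (setr 13 (RDiv (RGet 2 (IVar 13)) (RGet 7 (IVar 13))))
      (raise_cmd (IVar 11))))
    Skip)
  (Seq (setr 13 (RDiv (RVar 9)
      (RSub (RMul (ROfInt (IVar 1)) (RGet 7 (IVar 13))) (RVar 10))))
    (raise_cmd (INum 0))))).

Definition fix_cmd : cmd :=
  Seq (seti 13 (IGet 7 (IVar 11)))
  (If (BAnd (BAnd (BLeI (IVar 14) (IVar 11)) (BNot (BLeI (IVar 15) (IVar 11))))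
        (BLeR (RGet 5 (IVar 13)) (ROfInt (INum 0))))
    (SetR 5 (IVar 13) (RVar 8)) Skip).

Definition speeds_cmd : cmd :=
  For 10
    (Seq (setr 8 (ROfInt (INum 0)))
    (Seq (setr 9 (ROfInt (INum 0)))
    (Seq (setr 10 (ROfInt (INum 0)))
    (Seq (seti 14 (INum 0))
    (Seq (seti 15 (INum 0))
    (Seq (For 11 scan_cmd) (For 11 fix_cmd))))))).

Lemma count_iotaSr (a : pred nat) l :
  count a (iota 0 l.+1) = (count a (iota 0 l) + a l)%N.
Proof. by rewrite -[l.+1]addn1 iotaD count_cat /= addn0. Qed.

(** * Correctness of the window lengths and of the EDF order *)

Section Preparation.
Variables (R : realType) (N n m : nat) (sz : nat -> nat) (r d W : nat -> R).
Hypothesis nN : (n <= N)%N.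

Definition inputs (s : state R) : Prop :=
  [/\ imem s 0 0 = n, imem s 1 0 = m, forall i, imem s 2 i = sz i
    & [/\ forall i, rmem s 0 i = r i, forall i, rmem s 1 i = d i
        & forall i, rmem s 2 i = W i]].

Lemma inputs_frame c s s' : frame c s s' ->
  [&& ~~ int_written c 0, ~~ int_written c 1, ~~ int_written c 2,
      ~~ real_written c 0, ~~ real_written c 1 & ~~ real_written c 2] ->
  inputs s -> inputs s'.
Proof.
move=> [fi fr] /and5P[? ? ? ? /andP[? ?]] [h1 h2 h3 [h4 h5 h6]].
by split; [| | |split] => *; rewrite ?fi ?fr.
Qed.

Lemma windows_spec s : inputs s ->
  ends N windows_cmd s (fun s' => forall i, (i < n)%N -> rmem s' 7 i = d i - r i).
Proof.
move=> inp; have [n0 _ _ _] := inp.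
apply: (@ends_for _ _ (fun k s' => forall i, (i < k)%N -> rmem s' 7 i = d i - r i));
  rewrite ?n0 //.
move=> k s' kn fr hk IH; have [_ _ _ [hr hd _]] := inputs_frame fr isT inp.
apply/ends_setr => i /=; rewrite hk /upd /=; case: eqVneq => [-> _|ik].
  by rewrite hr hd.
by rewrite ltnS leq_eqVlt (negbTE ik) /=; apply: IH.
Qed.

Lemma ranks_spec s (D : nat -> R) : inputs s ->
  (forall i, (i < n)%N -> rmem s 7 i = D i) ->
  ends N ranks_cmd s (fun s' => sorting n D (imem s' 7)).
Proof.
move=> inp hD; have [n0 _ _ _] := inp.
apply: (@ends_for _ _ (fun k s' => forall i, (i < k)%N -> imem s' 7 (rank n D i) = i));
  rewrite ?n0 //; last first.
  by move=> s' _ h; apply: rank_sorting.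
move=> k s' kn fr hk IH.
have inp' := inputs_frame fr isT inp.
apply/ends_seq/ends_seti/ends_seq => /=.
set s1 := State _ _.
have [n1 _ _ _] : inputs s1 by [].
apply: (@ends_for _ _ (fun l s2 => imem s2 12 0 = count (before D ^~ k) (iota 0 l)));
  rewrite ?n1 //.
- move=> l s2 ln fr2 hl IH2.
  have e10 : imem s2 10 0 = k by rewrite fr2.1.
  have e7 i : rmem s2 7 i = rmem s 7 i by rewrite fr2.2 //; apply: fr.2.
  have eb : beval s2 (before_test (IVar 11) (IVar 10)) = before D l k.
    by rewrite /= e10 hl !e7 !hD.
  apply: ends_if; rewrite eb => hb.
    apply/ends_seti; move: (count_iotaSr (before D ^~ k) l) => /= ->.
    by rewrite hb /upd /= IH2.
  apply/ends_skip; move: (count_iotaSr (before D ^~ k) l) => /= ->.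
  by rewrite (negbTE hb) addn0.
(* Ranks are distinct, so writing the cell of rank [rank n D k] spares the earlier entries. *)
- move=> s2 fr2 hc; apply/ends_seti => i.
  have e10 : imem s2 10 0 = k by rewrite fr2.1.
  have e7 j : imem s2 7 j = imem s' 7 j by rewrite fr2.1.
  rewrite /= /upd /= e10 hc -/(rank n D k) => ik; case: eqP => [E|E].
    by apply: esym (rank_inj _ kn E); apply: leq_trans ik kn.
  rewrite e7; apply: IH; rewrite ltn_neqAle -ltnS ik andbT.
  by apply/eqP => ki; apply: E; rewrite ki.
Qed.

End Preparation.

(** * Correctness of the speed computation *)

Lemma ieval_rmem (R : realType) (s : state R) (mem : nat -> nat -> R) e :
  ieval (State (imem s) mem) e = ieval s e.
Proof. by elim: e => //= [a e ->|e1 -> e2 ->|e1 -> e2 ->]. Qed.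

Lemma raise_spec (R : realType) N (s : state R) e :
  ends N (raise_cmd e) s (fun s' =>
    if rmem s 13 0 <= rmem s 8 0 then
      [/\ rmem s' 8 0 = rmem s 8 0, imem s' 14 0 = imem s 14 0
        & imem s' 15 0 = imem s 15 0]
    else [/\ rmem s' 8 0 = rmem s 13 0, imem s' 14 0 = ieval s e
           & imem s' 15 0 = (imem s 11 0).+1]).
Proof.
apply: ends_if => /= [->|/negbTE->]; first exact: ends_skip.
apply/ends_seq/ends_setr/ends_seq/ends_seti/ends_seti => /=.
by rewrite ieval_rmem /upd /= addn1.
Qed.

Section SpeedProgram.
Variables (R : realType) (alpha : R) (N n m : nat) (sz : nat -> nat).
Variables (r d W D : nat -> R) (pi : nat -> nat).
Hypotheses (nN : (n <= N)%N) (alpha1 : 1 < alpha) (m0 : (0 < m)%N).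
Hypotheses (D0 : forall i, (i < n)%N -> 0 < D i)
  (W0 : forall i, (i < n)%N -> 0 < W i) (sz0 : forall i, (i < n)%N -> (0 < sz i)%N).
Hypothesis pi_sort : sorting n D pi.

Let Dp k := D (pi k).
Let Wp k := W (pi k).
Let szp k : R := (sz (pi k))%:R.

Definition prepared (s : state R) : Prop :=
  [/\ inputs n m sz r d W s, forall i, imem s 7 i = pi i
    & forall i, (i < n)%N -> rmem s 7 i = D i].

Lemma prepared_frame c s s' : frame c s s' ->
  [&& ~~ int_written c 0, ~~ int_written c 1, ~~ int_written c 2,
      ~~ real_written c 0, ~~ real_written c 1 & ~~ real_written c 2] ->
  ~~ int_written c 7 -> ~~ real_written c 7 ->
  prepared s -> prepared s'.
Proof.
move=> fr h h7 h7' [inp hpi hD]; split.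
- exact: inputs_frame fr h inp.
- by move=> i; rewrite fr.1.
- by move=> i iN; rewrite fr.2 // hD.
Qed.

(** Indexed by EDF position. The value 0 past the end makes an update an equality of functions. *)
Definition base_speed (s : state R) (k : nat) : R :=
  if (k < n)%N then rmem s 5 (pi k) else 0.

Let pi_n k : (k < n)%N -> (pi k < n)%N.
Proof. by case: pi_sort => h _ _ _; apply: h. Qed.

Lemma scan_spec s (v : nat -> R) : prepared s ->
  (forall k, (k < n)%N -> 0 <= v k) ->
  (forall k, (k < n)%N -> rmem s 5 (pi k) = v k) ->
  rmem s 8 0 = 0 -> rmem s 9 0 = 0 -> rmem s 10 0 = 0 ->
  imem s 14 0 = 0%N -> imem s 15 0 = 0%N ->
  ends N (For 11 scan_cmd) s (fun s' =>
    scan_inv m%:R Dp Wp szp v n (rmem s' 8 0) (imem s' 14 0) (imem s' 15 0)).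
Proof.
move=> prep v0 hv h8 h9 h10 h14 h15; have [[n0 _ _ _] _ _] := prep.
apply: (@ends_for _ _ (fun l s2 =>
    [/\ scan_inv m%:R Dp Wp szp v l (rmem s2 8 0) (imem s2 14 0) (imem s2 15 0),
        rmem s2 9 0 = unfixed_work Wp szp v l & rmem s2 10 0 = fixed_area Wp szp v l]));
  rewrite ?n0 //; last by move=> s' _ [].
- rewrite h8 h9 h10 h14 h15 /unfixed_work /fixed_area !big_geq //.
  by split=> //; split=> //; apply: Or31.
move=> l s2 ln fr2 hl [[t0 hdelta hdens hcase] hU hX].
have prep2 := prepared_frame fr2 isT isT isT prep.
have hv2 k : (k < n)%N -> rmem s2 5 (pi k) = v k by move=> kn; rewrite fr2.2 // hv.
have US : unfixed_work Wp szp v l.+1 =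
    unfixed_work Wp szp v l + if v l == 0 then szp l * Wp l else 0.
  by rewrite /unfixed_work big_nat_recr.
have XS : fixed_area Wp szp v l.+1 = fixed_area Wp szp v l + szp l * Wp l / v l.
  by rewrite /fixed_area big_nat_recr.
move: prep2 => [[n2 m2 s2E [_ _ W2]] pi2 D2].
apply/ends_seq/ends_seti/ends_seq/ends_setr/ends_seq.
set s3 := State _ _.
have fr3 : frame (For 11 scan_cmd) s2 s3.
  split=> a k /=; rewrite /upd.
    by rewrite !negb_or => /and3P[_ + _]; case: eqVneq => // ->.
  by rewrite !negb_or; case: (eqVneq a 10%N) => // ->.
(* The assertion between the two candidates of position [l]: its window has been accounted for, its
   density has not. *)
pose mid (s4 : state R) := [/\ rmem s4 9 0 = unfixed_work Wp szp v l.+1,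
  0 <= rmem s4 8 0,
  forall i, (i < l.+1)%N -> v i = 0 -> Wp i / Dp i <= rmem s4 8 0,
  forall i, (i < l)%N -> density m%:R Dp Wp szp v i <= rmem s4 8 0 &
  [\/ rmem s4 8 0 = 0 /\ imem s4 15 0 = 0%N,
      exists i, [/\ (i < l.+1)%N, v i = 0, rmem s4 8 0 = Wp i / Dp i,
         imem s4 14 0 = i & imem s4 15 0 = i.+1]
    | exists i, [/\ (i < l.+1)%N, rmem s4 8 0 = density m%:R Dp Wp szp v i,
         imem s4 14 0 = 0%N & imem s4 15 0 = i.+1]]].
have e13 : imem s3 13 0 = pi l by rewrite /s3 /= /upd /= hl pi2.
have e11 : imem s3 11 0 = l by rewrite /s3 /= /upd /= hl.
have e10 : rmem s3 10 0 = fixed_area Wp szp v l.+1.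
  by rewrite /s3 /= /upd /= hl pi2 hX s2E W2 hv2 // XS.
have e5 : rmem s3 5 (pi l) = v l by rewrite -hv2.
have eA : reval s3 area_exp = szp l * Wp l.
  by rewrite /= /upd /= hl pi2 s2E W2.
have vl0 : (v l <= 0) = (v l == 0) by rewrite eq_le v0 // andbT.
have old_case : [\/ rmem s2 8 0 = 0 /\ imem s2 15 0 = 0%N,
      exists i, [/\ (i < l.+1)%N, v i = 0, rmem s2 8 0 = Wp i / Dp i,
         imem s2 14 0 = i & imem s2 15 0 = i.+1]
    | exists i, [/\ (i < l.+1)%N, rmem s2 8 0 = density m%:R Dp Wp szp v i,
         imem s2 14 0 = 0%N & imem s2 15 0 = i.+1]].
  case: hcase => [h|[i [? ? ? ? ?]]|[i [? ? ? ?]]]; first exact: Or31.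
    by apply: Or32; exists i; split=> //; apply: ltnW.
  by apply: Or33; exists i; split=> //; apply: ltnW.
have midP : ends N (If (BLeR (RGet 5 (IVar 13)) (ROfInt (INum 0)))
    (Seq (setr 9 (RAdd (RVar 9) area_exp))
    (Seq (setr 13 (RDiv (RGet 2 (IVar 13)) (RGet 7 (IVar 13))))
      (raise_cmd (IVar 11)))) Skip) s3 mid.
  apply: ends_if; rewrite /= /upd /= hl pi2 hv2 // vl0 => vl.
    apply/ends_seq/ends_setr/ends_seq/ends_setr; set s4 := State _ _.
    have c4 : rmem s4 13 0 = Wp l / Dp l.
      by rewrite /s4 /= /upd /= hl pi2 W2 D2 ?pi_n.
    have u4 : rmem s4 9 0 = unfixed_work Wp szp v l.+1.
      by rewrite US vl -hU -eA.
    apply/ends_frame/(ends_mono _ (raise_spec N s4 (IVar 11))) => s5.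
    have -> : rmem s4 8 0 = rmem s2 8 0 by [].
    have -> : ieval s4 (IVar 11) = l by rewrite -[RHS]e11.
    have -> : imem s4 11 0 = l by rewrite -[RHS]e11.
    have -> : imem s4 14 0 = imem s2 14 0 by [].
    have -> : imem s4 15 0 = imem s2 15 0 by [].
    rewrite c4; case: ifPn => [le|]; last rewrite -ltNge => lt;
      move=> [g8 g14 g15] fr5; split; rewrite ?g8 ?g14 ?g15 //.
    - by rewrite fr5.2.
    - move=> i; rewrite ltnS leq_eqVlt => /predU1P[->//|il vi]; exact: hdelta.
    - by rewrite fr5.2.
    - exact: le_trans t0 (ltW lt).
    - move=> i; rewrite ltnS leq_eqVlt => /predU1P[->//|il vi].
      exact: le_trans (hdelta _ il vi) (ltW lt).
    - by move=> i il; apply: le_trans (hdens _ il) (ltW lt).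
    - by apply: Or32; exists l; split=> //; apply/eqP.
  apply/ends_skip; split.
  - by rewrite US (negbTE vl) addr0 -hU.
  - exact: t0.
  - move=> i; rewrite ltnS leq_eqVlt => /predU1P[->|il]; last exact: hdelta.
    by move=> v0l; rewrite v0l eqxx in vl.
  - exact: hdens.
  - exact: old_case.
apply/ends_frame/(ends_mono _ midP) => s4 [u4 t4 delta4 dens4 case4] fr4.
have x4 : rmem s4 10 0 = fixed_area Wp szp v l.+1 by rewrite fr4.2.
have j4 : imem s4 13 0 = pi l by rewrite fr4.1.
have k4 : imem s4 11 0 = l by rewrite fr4.1.
have m4 : imem s4 1 0 = m by rewrite fr4.1.
have d4 : rmem s4 7 (pi l) = Dp l by rewrite fr4.2 //; apply/D2/pi_n.
apply/ends_seq/ends_setr; set s5 := State _ _.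
have c5 : rmem s5 13 0 = density m%:R Dp Wp szp v l.
  by rewrite /s5 /= /upd /= u4 j4 m4 d4 x4.
apply/ends_frame/(ends_mono _ (raise_spec N s5 (INum 0))) => s6.
have -> : rmem s5 8 0 = rmem s4 8 0 by [].
have -> : ieval s5 (INum 0) = 0%N by [].
have -> : imem s5 11 0 = l by rewrite -[RHS]k4.
have -> : imem s5 14 0 = imem s4 14 0 by [].
have -> : imem s5 15 0 = imem s4 15 0 by [].
have U6 : frame (raise_cmd (INum 0)) s5 s6 -> rmem s6 9 0 = unfixed_work Wp szp v l.+1.
  by move=> fr6; rewrite fr6.2 // -[RHS]u4.
have X6 : frame (raise_cmd (INum 0)) s5 s6 -> rmem s6 10 0 = fixed_area Wp szp v l.+1.
  by move=> fr6; rewrite fr6.2 // -[RHS]x4.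
rewrite c5; case: ifPn => [le|]; last rewrite -ltNge => lt;
  move=> [g8 g14 g15] fr6; split; rewrite ?U6 ?X6 //; split; rewrite ?g8 ?g14 ?g15 //.
- by move=> i; rewrite ltnS leq_eqVlt => /predU1P[->//|il]; apply: dens4.
- exact: le_trans t4 (ltW lt).
- by move=> i il vi; apply: le_trans (delta4 _ il vi) (ltW lt).
- move=> i; rewrite ltnS leq_eqVlt => /predU1P[->//|il].
  exact: le_trans (dens4 _ il) (ltW lt).
- by apply: Or33; exists l.
Qed.

Lemma fix_spec s (v : nat -> R) : prepared s ->
  (forall k, (k < n)%N -> 0 <= v k) ->
  (forall k, (k < n)%N -> rmem s 5 (pi k) = v k) ->
  ends N (For 11 fix_cmd) s (fun s' => forall k, (k < n)%N ->
    rmem s' 5 (pi k) = fix_range v (rmem s 8 0) (imem s 14 0) (imem s 15 0) k).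
Proof.
move=> prep v0 hv; have [[n0 _ _ _] _ _] := prep.
have [_ pi_inj _ _] := pi_sort.
set v' := fix_range _ _ _ _.
apply: (@ends_for _ _ (fun l s2 => forall k, (k < n)%N ->
    rmem s2 5 (pi k) = if (k < l)%N then v' k else v k)); rewrite ?n0 //; last first.
  by move=> s' _ h k kn; rewrite h ?kn.
move=> l s2 ln fr2 hl IH.
have [_ pi2 _] := prepared_frame fr2 isT isT isT prep.
have v'l : v' l = if [&& (imem s 14 0 <= l)%N, ~~ (imem s 15 0 <= l)%N & v l <= 0]
    then rmem s 8 0 else v l.
  by rewrite /v' /fix_range -ltnNge andbA eq_le v0 // andbT.
apply/ends_seq/ends_seti; set s3 := State _ _.
have eb : beval s3 (BAnd (BAnd (BLeI (IVar 14) (IVar 11)) (BNot (BLeI (IVar 15) (IVar 11))))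
    (BLeR (RGet 5 (IVar 13)) (ROfInt (INum 0)))) =
    [&& (imem s 14 0 <= l)%N, ~~ (imem s 15 0 <= l)%N & v l <= 0].
  by rewrite /= /upd /= hl pi2 (IH l) // ltnn !fr2.1 // andbA.
apply: ends_if; rewrite eb => hb.
  apply/ends_setr => k kn; rewrite /= /upd /= hl pi2 fr2.2 // ltnS leq_eqVlt.
  case: (eqVneq k l) => [->|kl]; first by rewrite eqxx v'l hb.
  rewrite ifN; last by apply: contra_neq kl; apply: pi_inj.
  exact: IH.
apply/ends_skip => k kn /=; rewrite ltnS leq_eqVlt IH //.
by case: (eqVneq k l) => [->|//]; rewrite ltnn v'l (negbTE hb).
Qed.

Lemma speeds_spec s : prepared s ->
  (forall i, rmem s 5 i = 0) ->
  ends N speeds_cmd s (fun s' =>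
    speed_inv alpha n m%:R Dp Wp szp n (base_speed s')).
Proof.
move=> prep h5; have [[n0 _ _ _] _ _] := prep.
have m0' : 0 < m%:R :> R by rewrite ltr0n.
have D0' i : (i < n)%N -> 0 < Dp i by move=> /pi_n/D0.
have W0' i : (i < n)%N -> 0 < Wp i by move=> /pi_n/W0.
have sz0' i : (i < n)%N -> 0 < szp i by move=> /pi_n/sz0; rewrite ltr0n.
apply: (@ends_for _ _ (fun it s' =>
    speed_inv alpha n m%:R Dp Wp szp it (base_speed s'))); rewrite ?n0 //.
  have -> : base_speed s = fun=> 0 by apply/funext => k; rewrite /base_speed h5 if_same.
  exact: speed_inv0.
move=> it s1 itn fr1 hit inv.
have prep1 := prepared_frame fr1 isT isT isT prep.
set v := base_speed s1 in inv.
have v0 k : (k < n)%N -> 0 <= v k.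
  by move=> kn; case: inv => b [th [[_ _ h] _ _ _ _]]; have [] := h _ kn.
have hv k : (k < n)%N -> rmem s1 5 (pi k) = v k by rewrite /v /base_speed => ->.
do 5!(apply/ends_seq; (apply/ends_setr || apply/ends_seti)).
set s2 := State _ _.
apply/ends_seq/ends_frame.
apply: (ends_mono _ (@scan_spec s2 v prep1 v0 hv _ _ _ _ _)) => // s3 scan fr3.
have prep3 := prepared_frame fr3 isT isT isT prep1.
have hv3 k : (k < n)%N -> rmem s3 5 (pi k) = v k by move=> kn; rewrite fr3.2 //; exact: hv.
apply: (ends_mono _ (fix_spec prep3 v0 hv3)) => s4 h4.
have -> : base_speed s4 = fix_range v (rmem s3 8 0) (imem s3 14 0) (imem s3 15 0).
  apply/funext => k; rewrite /base_speed; case: ltnP => kn; first exact: h4.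
  have kf : (k < n)%N = false by rewrite ltnNge kn.
  (* Past the end nothing is fixed, as the scan leaves [hi <= n]. *)
  rewrite /fix_range /v /base_speed kf eqxx andbT ifN // negb_and -!ltnNge.
  apply/orP; right.
  have [_ _ _ [[_ ->]|[i [iN _ _ _ ->]]|[i [iN _ _ ->]]]] := scan => //;
    by rewrite ltnS (leq_trans _ kn) // ltnW.
exact: speed_inv_step.
Qed.

End SpeedProgram.

(** * Program text of the list scheduling phase *)

Definition emit_cmd (lo hi : iexp) (e : rexp) : cmd :=
  Seq (SetI 5 (IVar 18) lo) (Seq (SetI 6 (IVar 18) hi)
    (Seq (SetR 6 (IVar 18) e) (inc 18))).

(** Reads from pointer 22 up to limit 24. Without [keep] the copies get the end of the job, real
    variable 11, as their time; with [guarded] the loop stops at the first block available later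
    than that. *)
Definition copy_cmd (keep guarded : bool) : cmd :=
  let inside := BNot (BLeI (IVar 24) (IVar 22)) in
  While (if guarded then BAnd inside (BLeR (RGet 6 (IVar 22)) (RVar 11)) else inside)
    (Seq (emit_cmd (IGet 5 (IVar 22)) (IGet 6 (IVar 22))
           (if keep then RGet 6 (IVar 22) else RVar 11))
      (inc 22)).

Definition length_exp : iexp := ISub (IGet 6 (IVar 20)) (IGet 5 (IVar 20)).

(** Variable 20 is the current block, variable 19 the number of processors still wanted; the loop
    stops at the block that can supply all of them. *)
Definition find_cmd : cmd :=
  Seq (seti 20 (IVar 16)) (Seq (seti 19 (IGet 2 (IVar 13)))
    (While (BNot (BLeI (IVar 19) length_exp))
      (Seq (seti 19 (ISub (IVar 19) length_exp)) (inc 20)))).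

Definition scale_exp : rexp :=
  RSub (ROfInt (INum 3)) (RDiv (ROfInt (INum 4)) (ROfInt (IAdd (IVar 1) (INum 1)))).

(** With a common deadline time runs backwards: a job scheduled in [[S, S + P)] is executed in
    [[d - (S + P), d - S)]. *)
Definition start_exp (reversed : bool) : rexp :=
  if reversed then RSub (RGet 1 (IVar 13)) (RVar 11)
  else RAdd (RGet 0 (IVar 13)) (RGet 12 (IVar 10)).

(* Blocks occupy cells [base, end) of integer arrays 5, 6 and real array 6, with
   base and end in variables 16 and 17. The new list of blocks is written from
   [end] on, so that the blocks given to a job stay in memory as its output. *)
Definition assign_cmd (reversed : bool) : cmd :=
  Seq (seti 13 (IGet 7 (IVar 10)))
  (Seq (SetR 4 (IVar 13) (RMul scale_exp (RGet 5 (IVar 13))))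
  (Seq find_cmd
  (Seq (SetR 12 (IVar 10) (RGet 6 (IVar 20)))
  (Seq (setr 11 (RAdd (RGet 12 (IVar 10)) (RDiv (RGet 2 (IVar 13)) (RGet 4 (IVar 13)))))
  (Seq (SetR 3 (IVar 13) (start_exp reversed))
  (Seq (seti 18 (IVar 17))
  (Seq (emit_cmd (IAdd (IGet 5 (IVar 20)) (IVar 19)) (IGet 6 (IVar 20)) (RGet 6 (IVar 20)))
  (Seq (seti 22 (IAdd (IVar 20) (INum 1)))
  (Seq (seti 24 (IVar 17))
  (Seq (copy_cmd true true)
  (Seq (seti 23 (IVar 22))
  (Seq (SetI 3 (IVar 13) (IVar 18))
  (Seq (seti 22 (IVar 16))
  (Seq (seti 24 (IVar 20))
  (Seq (copy_cmd false false)
  (Seq (emit_cmd (IGet 5 (IVar 20)) (IAdd (IGet 5 (IVar 20)) (IVar 19)) (RVar 11))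
  (Seq (SetI 4 (IVar 13) (ISub (IVar 18) (IGet 3 (IVar 13))))
  (Seq (seti 22 (IVar 23))
  (Seq (seti 24 (IVar 17))
  (Seq (copy_cmd true false)
  (Seq (seti 16 (IVar 17)) (seti 17 (IVar 18))))))))))))))))))))))).

(** The initial list is the single block [(0, m, 0)]; its zeros and the base pointer are cells not
    yet written. *)
Definition schedule_cmd (reversed : bool) : cmd :=
  Seq (seti 17 (INum 1)) (Seq (SetI 6 (INum 0) (IVar 1))
    (For 10 (assign_cmd reversed))).

(** * Block lists in memory *)

Definition cell (R : realType) (s : state R) (i : nat) : block R :=
  (imem s 5 i, imem s 6 i, rmem s 6 i).

Definition cells (R : realType) (s : state R) (a b : nat) : seq (block R) :=
  [seq cell s i | i <- index_iota a b].

Section Cells.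
Variable R : realType.
Implicit Types s : state R.

Lemma cells_nil s a : cells s a a = [::].
Proof. by rewrite /cells /index_iota subnn. Qed.

Lemma cells_rcons s a b : (a <= b)%N -> cells s a b.+1 = rcons (cells s a b) (cell s b).
Proof.
move=> ab; rewrite /cells /index_iota subSn // -addn1 iotaD map_cat /= subnKC //.
by rewrite cats1.
Qed.

Lemma cells_cat s a b c : (a <= b)%N -> (b <= c)%N ->
  cells s a c = cells s a b ++ cells s b c.
Proof.
move=> ab bc; rewrite /cells -map_cat /index_iota; congr map.
have -> : (c - a = (b - a) + (c - b))%N by lia.
by rewrite iotaD; congr (_ ++ iota _ _); lia.
Qed.

Lemma cells_cons s a b : (a < b)%N -> cells s a b = cell s a :: cells s a.+1 b.
Proof.
by move=> ab; rewrite (@cells_cat s a a.+1 b) // cells_rcons // cells_nil.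
Qed.

Lemma eq_cells s s' a b : (forall i, (a <= i < b)%N -> cell s i = cell s' i) ->
  cells s a b = cells s' a b.
Proof. by move=> h; apply/eq_in_map => i; rewrite mem_index_iota => /h. Qed.

Lemma size_cells s a b : size (cells s a b) = (b - a)%N.
Proof. by rewrite size_map size_iota. Qed.

Definition appended s s' (b : block R) : Prop :=
  [/\ imem s' 18 0 = (imem s 18 0).+1, cell s' (imem s 18 0) = b
    & forall i, (i < imem s 18 0)%N -> cell s' i = cell s i].

Lemma appended_cells s s' b a : (a <= imem s 18 0)%N -> appended s s' b ->
  cells s' a (imem s' 18 0) = rcons (cells s a (imem s 18 0)) b.
Proof.
move=> aw [-> <- h]; rewrite cells_rcons //; congr rcons.
by apply: eq_cells => i /andP[_ /h].
Qed.

Lemma emit_spec N s (lo hi : iexp) (e : rexp) (b : block R) :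
  let w := imem s 18 0 in
  ieval s lo = b.1.1 ->
  (let s1 := State (upd (imem s) 5 w b.1.1) (rmem s) in ieval s1 hi = b.1.2) ->
  (let s2 := State (upd (upd (imem s) 5 w b.1.1) 6 w b.1.2) (rmem s) in
    reval s2 e = b.2) ->
  ends N (emit_cmd lo hi e) s (fun s' => appended s s' b).
Proof.
move=> w hlo hhi he; apply/ends_seq/ends_seti/ends_seq/ends_seti/ends_seq/ends_setr.
apply/ends_seti; rewrite /= hlo -/w /upd /= in hhi he *.
rewrite -/w hhi he; split=> /=; first by rewrite addn1.
  by rewrite /cell /= /upd /= eqxx -!surjective_pairing.
by move=> i iw; rewrite /cell /upd /= !ltn_eqF.
Qed.

(** The source ends at [q], not beyond the write pointer [w], so the copy never overwrites what it
    still has to read. *)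
Lemma copy_spec N s (keep guarded : bool) :
  let p := imem s 22 0 in let q := imem s 24 0 in let w := imem s 18 0 in
  (p <= q)%N -> (q <= w)%N -> (q - p <= N)%N ->
  ends N (copy_cmd keep guarded) s (fun s' => exists p',
    [/\ [/\ (p <= p' <= q)%N, imem s' 22 0 = p' & imem s' 18 0 = (w + (p' - p))%N],
        forall i, (i < w)%N -> cell s' i = cell s i,
        cells s' w (w + (p' - p)) =
          [seq (b.1, if keep then b.2 else rmem s 11 0) | b <- cells s p p']
      & if guarded then (forall b, b \in cells s p p' -> b.2 <= rmem s 11 0) /\
             (p' = q \/ rmem s 11 0 < rmem s 6 p')
        else p' = q]).
Proof.
move=> p q w pq qw qpN.
pose Inv k s' := [/\ (p + k <= q)%N, imem s' 22 0 = (p + k)%N, imem s' 18 0 = (w + k)%N,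
  forall i, (i < w)%N -> cell s' i = cell s i &
  cells s' w (w + k) = [seq (b.1, if keep then b.2 else rmem s 11 0) | b <- cells s p (p + k)]
  /\ (guarded -> forall b, b \in cells s p (p + k) -> b.2 <= rmem s 11 0)].
apply: (@ends_while _ _ Inv).
- by rewrite /Inv !addn0 !cells_nil.
- move=> k s1 fr [h1 h2 h3 h4 [h5 h6]] cond.
  have q1 : imem s1 24 0 = q by rewrite fr.1 //; case: (guarded).
  have f1 : rmem s1 11 0 = rmem s 11 0 by rewrite fr.2 //; case: (guarded).
  have [kq hF] : (p + k < q)%N /\ (guarded -> rmem s1 6 (p + k) <= rmem s 11 0).
    by move: cond; case: (guarded) => /=; rewrite q1 h2 ?f1 -ltnNge // => /andP[].
  have cE : cell s1 (p + k) = cell s (p + k) by apply: h4; lia.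
  pose b : block R := ((cell s (p + k)).1, if keep then (cell s (p + k)).2 else rmem s 11 0).
  have pw : (p + k == w + k)%N = false by lia.
  split; first lia.
  apply/ends_seq/ends_frame/(ends_mono _ (@emit_spec N s1 _ _ _ b _ _ _)).
  + move=> s2 [w2 b2 c2] fr2; apply/ends_seti.
    have w2' : imem s2 18 0 = (w + k.+1)%N by rewrite w2 h3 addnS.
    have c2' i : (i < w)%N -> cell s2 i = cell s i.
      by move=> iw; rewrite c2 ?h4 // h3; lia.
    split.
    * by rewrite addnS.
    * by rewrite /= /upd /= fr2.1 // h2 addn1 addnS.
    * exact: w2'.
    * exact: c2'.
    * rewrite addnS [in cells s p _]addnS !cells_rcons ?leq_addr //.
      split; last first.
        move=> g b0; rewrite mem_rcons inE => /predU1P[->|]; last exact: h6.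
        by rewrite -cE; apply: hF.
      rewrite map_rcons -h5; congr rcons.
        by apply: eq_cells => i /andP[_ ik]; rewrite -[RHS]c2 // h3.
      by rewrite -h3; exact: b2.
  + by case: cE => e5 _ _; rewrite /= h2.
  + by case: cE => _ e6 _; rewrite /= /upd /= h2.
  + by case: cE => _ _ e7; rewrite /b; case: (keep); rewrite /= /upd /= ?h2.
- move=> k s1 fr [h1 h2 h3 h4 [h5 h6]] cond.
  have q1 : imem s1 24 0 = q by rewrite fr.1 //; case: (guarded).
  have f1 : rmem s1 11 0 = rmem s 11 0 by rewrite fr.2 //; case: (guarded).
  exists (p + k)%N; rewrite addKn; split=> //; first by rewrite leq_addr.
  move: cond h6; case: (guarded) => /=; rewrite q1 h2 => cond h6; last first.
    by move: cond; rewrite negbK => cond; apply/eqP; rewrite eqn_leq h1.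
  split; first exact: h6.
  move: cond; rewrite negb_and negbK f1 -ltNge => /orP[cond|]; last first.
    have := h4 (p + k)%N; case: (ltnP (p + k) q) => [kq|kq _ _].
      by move=> /(_ (leq_trans kq qw)) [_ _ ->]; right.
    by left; apply/eqP; rewrite eqn_leq h1.
  by left; apply/eqP; rewrite eqn_leq h1.
Qed.

Lemma procs_of_rcons (l : seq (block R)) b :
  procs_of (rcons l b) = procs_of l ++ members b.
Proof. by rewrite -cats1 procs_of_cat procs_of_cons cats0. Qed.

Lemma find_block_spec N s (m : nat) :
  let base := imem s 16 0 in let e := imem s 17 0 in let z := imem s 2 (imem s 13 0) in
  (e - base <= N)%N -> (base <= e)%N -> (0 < z <= m)%N ->
  size (procs_of (cells s base e)) = m ->
  ends N find_cmd s (fun s' =>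
    let p := imem s' 20 0 in let q := imem s' 19 0 in
    [/\ (base <= p < e)%N, (0 < q)%N, (imem s 5 p + q <= imem s 6 p)%N
      & (size (procs_of (cells s base p)) + q)%N = z]).
Proof.
move=> base e z eN be /andP[z0 zm] szE.
apply/ends_seq/ends_seti/ends_seq/ends_seti; set s1 := State _ _.
pose Inv k s' := [/\ imem s' 20 0 = (base + k)%N, (base + k < e)%N, (0 < imem s' 19 0)%N
  & (size (procs_of (cells s base (base + k))) + imem s' 19 0)%N = z].
(* The list contains [m >= z] processors, so its end is not reached while some are still wanted. *)
have inside k' q : (base + k' <= e)%N -> (0 < q)%N ->
    (size (procs_of (cells s base (base + k'))) + q)%N = z -> (base + k' < e)%N.
  move=> le q0 hz; rewrite ltn_neqAle le andbT; apply/eqP => E.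
  by move: hz; rewrite E szE; lia.
have fr_cells s2 : frame (While (BNot (BLeI (IVar 19) length_exp))
      (Seq (seti 19 (ISub (IVar 19) length_exp)) (inc 20))) s1 s2 ->
    forall i, imem s2 5 i = imem s 5 i /\ imem s2 6 i = imem s 6 i.
  by move=> fr i; rewrite !fr.1.
apply: (@ends_while _ _ Inv).
- have z1 : imem s1 19 0 = z by [].
  split; [by rewrite addn0| |by rewrite z1|by rewrite addn0 cells_nil].
  by apply: (inside _ z); rewrite ?addn0 ?cells_nil.
- move=> k' s2 /fr_cells fc [h1 h2 h3 h4] /=.
  rewrite -ltnNge h1 !(fc _).1 !(fc _).2 => lt; split; first lia.
  apply/ends_seq/ends_seti/ends_seti.
  set q' := (imem s2 19 0 - (imem s 6 (base + k') - imem s 5 (base + k')))%N.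
  have hz : (size (procs_of (cells s base (base + k'.+1))) + q')%N = z.
    rewrite addnS cells_rcons ?leq_addr // procs_of_rcons size_cat size_iota -h4 /=.
    by rewrite -addnA; congr addn; rewrite /q' /=; lia.
  have q0 : (0 < q')%N by rewrite subn_gt0.
  have bk : (base + k'.+1 <= e)%N by rewrite addnS.
  split; rewrite /= /upd /= ?h1 ?(fc _).1 ?(fc _).2 -/q' //.
    by rewrite addn1 addnS.
  exact: inside bk q0 hz.
- move=> k' s2 /fr_cells fc [h1 h2 h3 h4] /=.
  rewrite negbK h1 !(fc _).1 !(fc _).2 => le; split=> //; first by rewrite leq_addr.
  lia.
Qed.

End Cells.

(** * One pass of the scheduling loop *)

Section Assign.
Variables (R : realType) (N n m : nat) (sz : nat -> nat).
Variables (r d W D : nat -> R) (pi : nat -> nat) (reversed : bool).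

Definition scale : R := 3 - 4 / (m%:R + 1).

Definition start_time (j : nat) (S P : R) : R :=
  if reversed then d j - (S + P) else r j + S.

(** The code performs the list operation of section [Step]. Blocks are written from cell [e] on
    only, so the outputs of earlier jobs persist. *)
Lemma assign_spec (s : state R) (k j : nat) (v : R) :
  let base := imem s 16 0 in let e := imem s 17 0 in
  let P := W j / (scale * v) in
  prepared n m sz r d W D pi s -> imem s 10 0 = k -> pi k = j -> rmem s 5 j = v ->
  (base <= e)%N -> (e - base <= N)%N -> size (procs_of (cells s base e)) = m ->
  (0 < sz j <= m)%N ->
  ends N (assign_cmd reversed) s (fun s' => exists L M1 M2 lo hi q S,
    let taken := [seq (b.1, S + P) | b <- rcons L (lo, (lo + q)%N, S)] in
    let e' := imem s' 17 0 in let o := imem s' 3 j in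
    [/\ cells s base e = L ++ (lo, hi, S) :: M1 ++ M2,
        [/\ (0 < q)%N, (lo + q <= hi)%N & (size (procs_of L) + q)%N = sz j],
        (forall b, b \in M1 -> b.2 <= S + P) /\
          (forall b M, M2 = b :: M -> S + P <= b.2),
        [/\ imem s' 16 0 = e, e' = (e + (e - base).+1)%N
          & cells s' e e' = ((lo + q)%N, hi, S) :: M1 ++ taken ++ M2]
      & [/\ [/\ (e <= o)%N, (o + imem s' 4 j <= e')%N
              & cells s' o (o + imem s' 4 j) = taken],
            [/\ rmem s' 12 k = S, rmem s' 4 j = scale * v
              & rmem s' 3 j = start_time j S P],
            forall i, (i < e)%N -> cell s' i = cell s i,
            forall i, i != j -> [/\ imem s' 3 i = imem s 3 i, imem s' 4 i = imem s 4 i,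
              rmem s' 3 i = rmem s 3 i & rmem s' 4 i = rmem s 4 i]
          & forall i, i != k -> rmem s' 12 i = rmem s 12 i]]).
Proof.
move=> base e P [[n0 m0 szE [rE dE WE]] piE DE] hk hj hv be eN szl zm.
apply/ends_seq/ends_seti/ends_seq/ends_setr/ends_seq.
set s1 := State _ _.
have j1 : imem s1 13 0 = j by rewrite /s1 /= /upd /= hk piE hj.
have z1 : imem s1 2 (imem s1 13 0) = sz j by rewrite j1 -szE.
have v1 i : rmem s1 4 i = if i == j then scale * v else rmem s 4 i.
  by rewrite /s1 /= /upd /= hk piE hj m0 natrD hv.
have zm1 : (0 < imem s1 2 (imem s1 13 0) <= m)%N by rewrite z1.
apply/ends_frame/(ends_mono _ (@find_block_spec _ N s1 m eN be zm1 szl)) => s2; set p := imem s2 20 0; set q := imem s2 19 0; rewrite z1.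
move=> [/andP[bp pe] q0 qle szq] fr2.
rewrite -[imem s1 16 0]/base in bp szq; rewrite -[imem s1 17 0]/e in pe.
have c2 i : cell s2 i = cell s i by rewrite /cell !fr2.1 // fr2.2.
set S := rmem s 6 p; set lo := imem s 5 p in qle; set hi := imem s 6 p in qle.
have j2 : imem s2 13 0 = j by rewrite fr2.1.
have k2 : imem s2 10 0 = k by rewrite fr2.1.
have b2 : imem s2 16 0 = base by rewrite fr2.1.
have e2 : imem s2 17 0 = e by rewrite fr2.1.
have v2 i : rmem s2 4 i = if i == j then scale * v else rmem s 4 i by rewrite fr2.2.
have W2 : rmem s2 2 j = W j by rewrite fr2.2 // -WE.
have r2 : rmem s2 0 j = r j by rewrite fr2.2 // -rE.
have d2 : rmem s2 1 j = d j by rewrite fr2.2 // -dE.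
have S2 : rmem s2 6 p = S by have [] := c2 p.
apply/ends_seq/ends_setr/ends_seq/ends_setr/ends_seq/ends_setr/ends_seq/ends_seti.
set s3 := State _ _.
have T3 i : rmem s3 12 i = if i == k then S else rmem s 12 i.
  by rewrite /s3 /= /upd /= k2 S2; case: eqP => // _; rewrite fr2.2.
have F3 : rmem s3 11 0 = S + P.
  by rewrite /s3 /= /upd /= k2 j2 eqxx S2 W2 v2 eqxx.
have st3 i : rmem s3 3 i = if i == j then start_time j S P else rmem s 3 i.
  rewrite /s3 /= /start_exp /start_time; case: (reversed); rewrite /= /upd /= ?j2 ?k2;
    by case: eqP => [_|_]; rewrite ?eqxx ?S2 ?W2 ?v2 ?r2 ?d2 ?eqxx // fr2.2.
have w3 : imem s3 18 0 = e by rewrite -e2.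
have c3 i : cell s3 i = cell s i by rewrite -c2.
have p3 : imem s3 20 0 = p by [].
have q3 : imem s3 19 0 = q by [].
have o3 i : imem s3 3 i = imem s 3 i /\ imem s3 4 i = imem s 4 i.
  by split; [rewrite -[RHS]/(imem s1 3 i)|rewrite -[RHS]/(imem s1 4 i)]; rewrite -fr2.1.
have j3 : imem s3 13 0 = j by [].
have v3 i : rmem s3 4 i = if i == j then scale * v else rmem s 4 i by rewrite -v2.
have base3 : imem s3 16 0 = base by [].
have e3 : imem s3 17 0 = e by [].
clearbody s3 p q base e.
apply/ends_frame/ends_seq/ends_frame/(ends_mono _
  (@emit_spec _ N s3 _ _ _ ((lo + q)%N, hi, S) _ _ _)); first last.
- by rewrite /= /upd /= p3; have [_ _] := c3 p.
- by rewrite /= w3 /upd /= p3; have [_ ->] := c3 p.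
- by rewrite /= p3 q3; have [-> _] := c3 p.
move=> s4 [w4 b4 c4] fr4; rewrite w3 in w4 b4 c4.
apply/ends_seq/ends_seti/ends_seq/ends_seti/ends_seq.
set s5 := State _ _.
have p4 : imem s4 20 0 = p by rewrite fr4.1.
have e4 : imem s4 17 0 = e by rewrite fr4.1.
have p5 : imem s5 22 0 = p.+1 by rewrite /s5 /= /upd /= p4 addn1.
have q5 : imem s5 24 0 = e by rewrite -e4.
have w5 : imem s5 18 0 = e.+1 by rewrite -w4.
have F5 : rmem s5 11 0 = S + P by rewrite -F3 -[LHS]/(rmem s4 11 0) fr4.2.
have c5 i : (i < e)%N -> cell s5 i = cell s i by move=> ie; rewrite -c3 -c4.
have fr5 a i : ~~ (a \in [:: 5; 6; 18; 22; 24]%N) -> imem s5 a i = imem s3 a i.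
  rewrite !inE !negb_or => /and5P[h5 h6 h18 h22 h24].
  rewrite /s5 /= /upd (negbTE h22) (negbTE h24) /= fr4.1 //= !negb_or h5 h6 h18 //.
have b5 : cell s5 e = ((lo + q)%N, hi, S) by rewrite -b4.
clearbody s5.
have as5 : (imem s5 22 0 <= imem s5 24 0)%N by rewrite p5 q5; lia.
have as5' : (imem s5 24 0 <= imem s5 18 0)%N by rewrite q5 w5; lia.
have as5'' : (imem s5 24 0 - imem s5 22 0 <= N)%N by rewrite q5 p5; lia.
(* After the remainder of the split block, [M1] is copied; the guard stops the copy where [M2]
   begins. *)
apply/ends_frame/(ends_mono _ (@copy_spec _ N s5 true true as5 as5' as5''));
  rewrite p5 q5 w5.
move=> s6 [p' [[/andP[pp' p'e] p6 w6] c6 l6 [M1le nxt]]] fr6; rewrite F5 in M1le nxt.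
have c6' i : (i < e)%N -> cell s6 i = cell s i.
  by move=> ie; rewrite c6 ?c5 //; apply: leq_trans ie _.
have b6 : cell s6 e = ((lo + q)%N, hi, S) by rewrite c6.
pose M1 := cells s p.+1 p'.
have M1E : cells s5 p.+1 p' = M1.
  by apply: eq_cells => i /andP[_ ip]; apply: c5; apply: leq_trans ip p'e.
rewrite M1E in M1le; rewrite M1E in l6.
have {}l6 : cells s6 e.+1 (imem s6 18 0) = M1.
  by rewrite w6 l6 -[RHS]map_id; apply: eq_map => -[].
apply/ends_seq/ends_seti/ends_seq/ends_seti/ends_seq/ends_seti/ends_seq/ends_seti/ends_seq.
set s7 := State _ _; set o := imem s6 18 0.
have fr6' a i : ~~ (a \in [:: 5; 6; 18; 22; 24]%N) -> imem s6 a i = imem s3 a i.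
  move=> ha; rewrite fr6.1 ?fr5 //=.
  by move: ha; rewrite !inE !negb_or => /and5P[-> -> -> -> _].
have j6 : imem s6 13 0 = j by rewrite fr6'.
have p20 : imem s6 20 0 = p by rewrite fr6'.
have q6 : imem s6 19 0 = q by rewrite fr6'.
have e6 : imem s6 17 0 = e by rewrite fr6'.
have base6 : imem s6 16 0 = base by rewrite fr6'.
have oe : (e < o)%N by rewrite /o w6; lia.
have out7 i : imem s7 3 i = if i == j then o else imem s 3 i.
  by rewrite /s7 /= /upd /= j6; case: eqP => // _; rewrite fr6' // (o3 i).1.
have p7 : imem s7 22 0 = base by rewrite -base6.
have q7 : imem s7 24 0 = p by rewrite -p20.
have w7 : imem s7 18 0 = o by [].
have F7 : rmem s7 11 0 = S + P by rewrite -F5 -[LHS]/(rmem s6 11 0) fr6.2.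
have c7 i : cell s7 i = cell s6 i by [].
have r7 : imem s7 23 0 = p' by rewrite -p6.
have j7 : imem s7 13 0 = j by [].
have p207 : imem s7 20 0 = p by [].
have q197 : imem s7 19 0 = q by [].
have e7 : imem s7 17 0 = e by [].
have cnt7 i : imem s7 4 i = imem s 4 i by rewrite -(o3 i).2 -fr6'.
clearbody s7.
have as7 : (imem s7 22 0 <= imem s7 24 0)%N by rewrite p7 q7; lia.
have as7' : (imem s7 24 0 <= imem s7 18 0)%N by rewrite q7 w7; lia.
have as7'' : (imem s7 24 0 - imem s7 22 0 <= N)%N by rewrite q7 p7; lia.
(* [L] is copied with the new time [S + P], from cell [o] on, where the output of job [j] begins. *)
apply/ends_frame/(ends_mono _ (@copy_spec _ N s7 false false as7 as7' as7''));
  rewrite p7 q7 w7.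
move=> s8 [x8 [[_ _ w8] c8 l8 x8E]] fr8; rewrite x8E in w8 l8; rewrite F7 in l8.
have po : (p < o)%N by lia.
rewrite (_ : cells s7 base p = cells s base p) in l8; last first.
  by apply: eq_cells => i /andP[_ ip]; rewrite c7 c6' //; apply: ltn_trans ip pe.
set L := cells s base p in l8.
have c8' i : (i < e)%N -> cell s8 i = cell s i.
  by move=> ie; rewrite c8 ?c7 ?c6' //; apply: ltn_trans ie oe.
have p8 : imem s8 20 0 = p by rewrite fr8.1.
have q8 : imem s8 19 0 = q by rewrite fr8.1.
have F8 : rmem s8 11 0 = S + P by rewrite fr8.2.
have j8 : imem s8 13 0 = j by rewrite fr8.1.
have e8 : imem s8 17 0 = e by rewrite fr8.1.
have r8 : imem s8 23 0 = p' by rewrite fr8.1.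
have out8 i : imem s8 3 i = if i == j then o else imem s 3 i by rewrite fr8.1 // out7.
have pne8 : (p == imem s8 18 0) = false by rewrite w8; lia.
(* The taken part of the split block completes the output of [j]. *)
apply/ends_seq/ends_frame/(ends_mono _
  (@emit_spec _ N s8 _ _ _ (lo, (lo + q)%N, S + P) _ _ _)); first last.
- by rewrite /= F8.
- by rewrite /= /upd /= p8 q8 pne8; have [-> _] := c8' _ pe.
- by rewrite /= p8; have [->] := c8' _ pe.
move=> s9 app9 fr9; have [w9 _ c9] := app9.
pose taken : seq (block R) := [seq (b.1, S + P) | b <- rcons L (lo, (lo + q)%N, S)].
have l9 : cells s9 o (imem s9 18 0) = taken.
  rewrite (appended_cells _ app9) ?w8 ?leq_addr // l8 /taken map_rcons //.
have sztaken : size taken = (p - base).+1 by rewrite size_map size_rcons size_cells.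
have w9' : imem s9 18 0 = (o + size taken)%N by rewrite w9 w8 sztaken addnS.
have c9' i : (i < o)%N -> cell s9 i = cell s6 i.
  by move=> io; rewrite c9 ?c8 ?c7 // w8 (leq_trans io) ?leq_addr.
have j9 : imem s9 13 0 = j by rewrite fr9.1.
have e9 : imem s9 17 0 = e by rewrite fr9.1.
have r9 : imem s9 23 0 = p' by rewrite fr9.1.
have out9 i : imem s9 3 i = if i == j then o else imem s 3 i by rewrite fr9.1.
have cnt9 i : imem s9 4 i = imem s 4 i by rewrite fr9.1 // fr8.1.
apply/ends_seq/ends_seti/ends_seq/ends_seti/ends_seq/ends_seti/ends_seq.
set s10 := State _ _.
have cnt10 i : imem s10 4 i = if i == j then size taken else imem s 4 i.
  by rewrite /s10 /= /upd /= j9 out9 eqxx w9' addKn; case: eqP.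
have out10 i : imem s10 3 i = if i == j then o else imem s 3 i by rewrite -out9.
have p10 : imem s10 22 0 = p' by rewrite -r9.
have q10 : imem s10 24 0 = e by rewrite -e9.
have w10 : imem s10 18 0 = (o + size taken)%N by rewrite -w9'.
have c10 i : cell s10 i = cell s9 i by [].
have e10 : imem s10 17 0 = e by rewrite -e9.
clearbody s10.
have as10 : (imem s10 22 0 <= imem s10 24 0)%N by rewrite p10 q10; lia.
have as10' : (imem s10 24 0 <= imem s10 18 0)%N by rewrite q10 w10; lia.
have as10'' : (imem s10 24 0 - imem s10 22 0 <= N)%N by rewrite q10 p10; lia.
(* [M2] closes the new list, with its times kept. *)
apply/ends_frame/(ends_mono _ (@copy_spec _ N s10 true false as10 as10' as10'')).
rewrite p10 q10 w10 => s11 [x11 [[_ _ w11] c11 l11 x11E]] fr11.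
rewrite x11E in w11 l11.
have szlo : (e < o + size taken)%N by lia.
have oE : o = (e.+1 + (p' - p.+1))%N by rewrite /o w6.
have c11' i : (i < o)%N -> cell s11 i = cell s6 i.
  by move=> io; rewrite c11 ?c10 ?c9' //; apply: leq_trans io (leq_addr _ _).
have e11 : imem s11 17 0 = e by rewrite fr11.1.
have out11 i : imem s11 3 i = if i == j then o else imem s 3 i by rewrite fr11.1.
have cnt11 i : imem s11 4 i = if i == j then size taken else imem s 4 i by rewrite fr11.1.
have taken11 : cells s11 o (o + size taken) = taken.
  rewrite -[RHS]l9 w9'; apply: eq_cells => i /andP[_ io]; rewrite c11 //.
pose M2 := cells s p' e.
have M2E : cells s11 (o + size taken) (imem s11 18 0) = M2.
  rewrite w11 l11 -[RHS]map_id; have -> : cells s10 p' e = M2.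
    apply: eq_cells => i /andP[_ ie]; rewrite c10 c9' ?c6' //; exact: ltn_trans ie oe.
  by apply: eq_map => -[].
apply/ends_seq/ends_seti/ends_seti; set s12 := State _ _.
move=> fr12; exists L, M1, M2, lo, hi, q, S; lazy zeta.
have E12 : imem s12 17 0 = imem s11 18 0 by [].
have o12 : imem s12 3 j = o by rewrite -[LHS]/(imem s11 3 j) out11 eqxx.
have cnt12 : imem s12 4 j = size taken by rewrite -[LHS]/(imem s11 4 j) cnt11 eqxx.
rewrite o12 cnt12 E12 -/taken.
have w11' : imem s11 18 0 = (e + (e - base).+1)%N by rewrite w11 oE sztaken; lia.
have ow : (o + size taken <= imem s11 18 0)%N by rewrite w11 leq_addr.
split.
- rewrite (@cells_cat _ s base p e) ?(ltnW pe) // (@cells_cons _ s p e) //.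
  by rewrite (@cells_cat _ s p.+1 p' e).
- by split.
- split; first exact: M1le.
  move=> b M M2b; have [pe'|lt] := nxt.
    by move: M2b; rewrite /M2 pe' cells_nil.
  have p'lt : (p' < e)%N.
    by rewrite ltnNge; apply/negP => ep; move: M2b; rewrite /M2 /cells /index_iota (eqP ep).
  move: M2b; rewrite /M2 cells_cons // => -[<- _] /=.
  by have [_ _ <-] := c5 _ p'lt; apply: ltW.
- split; [by rewrite -e11|exact: w11'|].
  rewrite cells_cons; last by rewrite w11'; lia.
  have -> : cell s12 e = ((lo + q)%N, hi, S) by rewrite -[LHS]/(cell s11 e) c11' // b6.
  rewrite (@cells_cat _ _ _ o) //; last exact: leq_trans (leq_addr _ _) ow.
  rewrite (@cells_cat _ _ o (o + size taken)) ?leq_addr //.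
  rewrite -[cells s12 o _]/(cells s11 o (o + size taken)) taken11.
  rewrite -[cells s12 _ (imem s11 18 0)]/(cells s11 (o + size taken) (imem s11 18 0)) M2E.
  congr (_ :: _ ++ _); rewrite -[RHS]l6.
  by apply: eq_cells => i /andP[_ io]; apply: c11'.
- split.
  + by split; [exact: ltnW|exact: ow|exact: taken11].
  + split; first by rewrite fr12.2 // T3 eqxx.
      by rewrite fr12.2 // v3 eqxx.
    by rewrite fr12.2 // st3 eqxx.
  + move=> i ie; rewrite -[LHS]/(cell s11 i) c11' ?c6' //; exact: ltn_trans ie oe.
  + move=> i ij; split.
    * by rewrite -[LHS]/(imem s11 3 i) out11 (negbTE ij).
    * by rewrite -[LHS]/(imem s11 4 i) cnt11 (negbTE ij).
    * by rewrite fr12.2 // st3 (negbTE ij).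
    * by rewrite fr12.2 // v3 (negbTE ij).
  + by move=> i ik; rewrite fr12.2 // T3 (negbTE ik).
Qed.
End Assign.

(** * The whole scheduling loop *)

Section Schedule.
Variables (R : realType) (N n m : nat) (sz : nat -> nat).
Variables (r d W D : nat -> R) (pi : nat -> nat) (reversed : bool) (v : nat -> R).
Hypotheses (nN : (n <= N)%N) (m0 : (0 < m)%N).
Hypotheses (W0 : forall i, (i < n)%N -> 0 < W i)
  (sz0 : forall i, (i < n)%N -> (0 < sz i)%N)
  (sz_half : forall i, (i < n)%N -> ((sz i).*2 <= m)%N).
Hypothesis pi_sort : sorting n D pi.
Hypotheses (v0 : forall k, (k < n)%N -> 0 < v k)
  (v_window : forall k, (k < n)%N -> W (pi k) / D (pi k) <= v k)
  (v_area : forall k, (k < n)%N ->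
    \sum_(0 <= i < k.+1) (sz (pi i))%:R * W (pi i) / v i <= m%:R * D (pi k))
  (D0 : forall i, (i < n)%N -> 0 < D i).

Definition duration (k : nat) : R := W (pi k) / (scale R m * v k).

Definition job_procs (s : state R) (j : nat) : seq nat :=
  procs_of (cells s (imem s 3 j) (imem s 3 j + imem s 4 j)).

Definition job_ok (s : state R) (k : nat) (S : R) : Prop :=
  let j := pi k in
  [/\ size (job_procs s j) = sz j, uniq (job_procs s j),
      forall p, p \in job_procs s j -> (p < m)%N
    & [/\ 0 <= S, S + duration k <= D j, rmem s 4 j = scale R m * v k
        & rmem s 3 j = start_time r d reversed j S (duration k)]].

(** A job adds exactly one block, so job [k < n] meets [k.+1 <= n] blocks, which bounds the inner
    loops. The fourth clause, on the ends of earlier jobs, carries the fifth, on disjointness, over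
    to the next job. *)
Definition schedule_inv (k : nat) (s : state R) : Prop :=
  let base := imem s 16 0 in let e := imem s 17 0 in let S i := rmem s 12 i in
  [/\ e = (base + k.+1)%N,
      exists T, blocks_inv m (cells s base e) T
        (\sum_(0 <= i < k) (sz (pi i))%:R * duration i),
      forall i, (i < k)%N -> job_ok s i (S i),
      forall i, (i < k)%N -> (imem s 3 (pi i) + imem s 4 (pi i) <= e)%N /\
        forall p, p \in job_procs s (pi i) ->
          forall b, b \in cells s base e -> p \in members b -> S i + duration i <= b.2
    & forall i i' p, (i < i' < k)%N -> p \in job_procs s (pi i) ->
        p \in job_procs s (pi i') -> S i + duration i <= S i'].

Lemma scale_gt0 : 0 < scale R m.
Proof.
have m1 : 1 <= m%:R :> R by rewrite ler1n.
have : 4 / (m%:R + 1) <= 2 :> R by rewrite ler_pdivrMr; lra.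
by rewrite /scale; lra.
Qed.

Let pi_n k : (k < n)%N -> (pi k < n)%N.
Proof. by case: pi_sort => h _ _ _; apply: h. Qed.

Lemma duration_gt0 k : (k < n)%N -> 0 < duration k.
Proof. by move=> kn; rewrite divr_gt0 ?W0 ?pi_n // mulr_gt0 ?scale_gt0 ?v0. Qed.

Lemma durationE k : (k < n)%N -> duration k * scale R m = W (pi k) / v k.
Proof.
move=> kn; have c0 := scale_gt0; have vk := v0 kn.
by rewrite /duration; field; rewrite !gt_eqF.
Qed.

Lemma duration_window k : (k < n)%N -> duration k <= D (pi k) / scale R m.
Proof.
move=> kn; have c0 := scale_gt0; have vk := v0 kn; have Dk := D0 (pi_n kn).
rewrite ler_pdivlMr // durationE // ler_pdivrMr // mulrC -ler_pdivrMr //.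
exact: v_window.
Qed.

Lemma duration_area k : (k < n)%N ->
  \sum_(0 <= i < k.+1) (sz (pi i))%:R * duration i <= m%:R * D (pi k) / scale R m.
Proof.
move=> kn; have c0 := scale_gt0; rewrite ler_pdivlMr // mulr_suml.
rewrite (eq_big_nat _ _ (F2 := fun i => (sz (pi i))%:R * W (pi i) / v i)) ?v_area //.
by move=> i /andP[_ ik]; rewrite -(mulrA _ (duration i)) durationE ?mulrA //; apply: leq_trans ik _.
Qed.

Lemma job_procs_frame s s' j e :
  (forall i, (i < e)%N -> cell s' i = cell s i) ->
  imem s' 3 j = imem s 3 j -> imem s' 4 j = imem s 4 j ->
  (imem s 3 j + imem s 4 j <= e)%N -> job_procs s' j = job_procs s j.
Proof.
move=> hc h3 h4 he; rewrite /job_procs h3 h4; congr procs_of.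
by apply: eq_cells => i /andP[_ ie]; apply: hc; apply: leq_trans ie he.
Qed.

Lemma schedule_step s1 k : (k < n)%N ->
  prepared n m sz r d W D pi s1 -> imem s1 10 0 = k ->
  (forall i, (i < n)%N -> rmem s1 5 (pi i) = v i) ->
  schedule_inv k s1 -> ends N (assign_cmd reversed) s1 (schedule_inv k.+1).
Proof.
move=> kn prep hk hv [eE [T inv] jobs ends_le disj].
set base := imem s1 16 0 in eE inv ends_le; set e := imem s1 17 0 in eE inv ends_le.
have jn := pi_n kn; set j := pi k in jn.
have pi_inj : forall i, (i < k)%N -> pi i != j.
  move=> i ik; apply/eqP => E; have [_ inj _ _] := pi_sort.
  by have ek := inj _ _ (ltn_trans ik kn) kn E; rewrite ek ltnn in ik.
have szl : size (procs_of (cells s1 base e)) = m.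
  by have [/perm_size-> _ _ _ _] := inv; rewrite size_iota.
have zm : (0 < sz j <= m)%N.
  by rewrite sz0 //=; have := sz_half jn; rewrite -addnn; apply/leq_trans/leq_addr.
have be : (base <= e)%N by rewrite eE leq_addr.
have eN : (e - base <= N)%N by rewrite eE addKn; apply: leq_trans kn nN.
apply/(ends_mono _ (@assign_spec _ N n m sz r d W D pi reversed s1 k j (v k) prep hk
  erefl (hv _ kn) be eN szl zm)) => s'.
move=> [L [M1 [M2 [lo [hi [q [S]]]]]]]; lazy zeta.
rewrite -/base -/e -/(duration k); set taken := [seq _ | _ <- rcons _ _].
move=> [lE [q0 qhi szq] [M1le M2ge] [b' e' l']].
move=> [[eo oe' takenE] [S' v' st'] cE other otherS].
have P0 := ltW (duration_gt0 kn).
rewrite lE in inv.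
have inv' := blocks_inv_step inv q0 qhi szq (sz_half jn) P0 M1le M2ge.
have hA := start_area inv q0 qhi szq (sz_half jn) P0.
have tsz := taken_size lo S (duration k) szq.
have S0 : 0 <= S by have [_ _ _ T0 _] := inv; apply: le_trans T0 (start_ge inv).
have Ck : job_procs s' j = procs_of taken by rewrite /job_procs takenE.
have Ci i : (i < k)%N -> job_procs s' (pi i) = job_procs s1 (pi i).
  move=> ik; have [h _] := ends_le _ ik; have [h3 h4 _ _] := other _ (pi_inj _ ik).
  exact: job_procs_frame cE h3 h4 h.
have Si i : (i < k)%N -> rmem s' 12 i = rmem s1 12 i.
  by move=> ik; rewrite otherS // ltn_eqF.
have early i p : (i < k)%N -> p \in job_procs s1 (pi i) ->
    forall b, b \in L ++ (lo, hi, S) :: M1 ++ M2 -> p \in members b ->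
      rmem s1 12 i + duration i <= b.2.
  by move=> ik; rewrite -lE; have [_ h] := ends_le _ ik; apply: h.
split; rewrite ?b' -?e' ?l'.
- by rewrite e' eE addKn addnS.
- by exists S; rewrite big_nat_recr //=.
- move=> i; rewrite ltnS leq_eqVlt => /predU1P[->|ik]; last first.
    have [h1 h2 h3 [h4 h5 h6 h7]] := jobs _ ik.
    have [_ _ o3 o4] := other _ (pi_inj _ ik).
    by rewrite /job_ok Ci ?Si ?o3 ?o4.
  rewrite S' /job_ok -/j Ck; split.
  + exact: tsz.
  + exact: taken_uniq inv q0 qhi szq (sz_half jn) P0.
  + exact: taken_lt inv q0 qhi szq (sz_half jn) P0.
  + split=> //.
    (* The area so far together with that of job [k] is the prefix sum bounded by
       [duration_area]. *)
    apply: (@list_schedule_in_time _ m (sz j) S (duration k) _ (D j) m0 _ P0 hA).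
    * by case/andP: zm.
    * by have := duration_area kn; rewrite big_nat_recr.
    * exact: duration_window.
- move=> i; rewrite ltnS leq_eqVlt => /predU1P[->|ik].
    split; first exact: oe'.
    rewrite -/j Ck S' => p hp b; apply: (taken_end inv q0 qhi szq (sz_half jn) P0 M2ge hp).
  have [h3 h4 _ _] := other _ (pi_inj _ ik); have [hle _] := ends_le _ ik.
  split; first by rewrite h3 h4 e'; apply: leq_trans hle (leq_addr _ _).
  rewrite Ci // Si // => p hp b.
  apply: (ends_preserved inv q0 qhi szq (sz_half jn) P0 (early _ _ ik hp)).
- move=> i i' p /andP[ii']; rewrite ltnS leq_eqVlt => /predU1P[E|ik'].
    rewrite E in ii' *; rewrite -/j Ck Ci // Si // S' => hp.
    apply: (taken_available inv q0 qhi szq (sz_half jn) P0 (early _ _ ii' hp)).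
  have ik := ltn_trans ii' ik'.
  by rewrite !Ci // !Si //; apply: disj; rewrite ii'.
Qed.

Lemma schedule_spec s : prepared n m sz r d W D pi s ->
  (forall k, (k < n)%N -> rmem s 5 (pi k) = v k) ->
  imem s 16 0 = 0%N -> imem s 5 0 = 0%N -> rmem s 6 0 = 0 ->
  ends N (schedule_cmd reversed) s (fun s' => exists S : nat -> R,
    (forall k, (k < n)%N -> job_ok s' k (S k)) /\
    forall i i' p, (i < i' < n)%N -> p \in job_procs s' (pi i) ->
      p \in job_procs s' (pi i') -> S i + duration i <= S i').
Proof.
move=> prep hv h16 h5 h6; have [[n0 m1 _ _] _ _] := prep.
apply/ends_seq/ends_seti/ends_seq/ends_seti; set s1 := State _ _.
have prep1 : prepared n m sz r d W D pi s1 by [].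
apply: (@ends_for _ _ schedule_inv); rewrite -?[imem s1 0 0]/(imem s 0 0) ?n0 //.
- have b1 : imem s1 16 0 = 0%N by exact: h16.
  rewrite /schedule_inv b1; split=> // [|i i' p]; last by rewrite andbC.
  exists 0; rewrite big_geq //.
  have -> : cells s1 0 (imem s1 17 0) = [:: (0%N, m, 0)].
    by rewrite /cells /= /cell /= /upd /= h5 h6 m1.
  exact: blocks_inv0.
- move=> k s2 kn fr hk inv.
  apply: (schedule_step kn _ hk _ inv).
    exact: prepared_frame fr isT isT isT prep1.
  by move=> i iN; rewrite fr.2 //; apply: hv.
- by move=> s2 fr [_ _ jobs _ disj]; exists (fun i => rmem s2 12 i).
Qed.

End Schedule.

(** * Energy *)

Import numFieldNormedType.Exports.

(** Young's inequality for [s] and [u ^ (alpha - 1)] with the conjugate exponents [alpha] and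
    [alpha / (alpha - 1)], multiplied by [alpha]. *)
Lemma powR_tangent (R : realType) (alpha u s : R) : 1 < alpha -> 0 < u -> 0 <= s ->
  alpha * u `^ (alpha - 1) * s <= s `^ alpha + (alpha - 1) * u `^ alpha.
Proof.
move=> a1 u0 s0; have a0 : 0 < alpha by lra.
have b0 : 0 < alpha - 1 by lra.
have := @conjugate_powR _ s (u `^ (alpha - 1)) alpha (alpha / (alpha - 1)) s0
  (powR_ge0 _ _) a0 (divr_gt0 a0 b0).
have -> : alpha^-1 + (alpha / (alpha - 1))^-1 = 1 by field; rewrite !gt_eqF.
move=> /(_ erefl); rewrite -powRrM (_ : (alpha - 1) * (alpha / (alpha - 1)) = alpha);
  last by field; rewrite gt_eqF.
rewrite -(ler_pM2l a0); congr (_ <= _); first by ring.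
by field; rewrite !gt_eqF.
Qed.

Lemma integral_powR_ge (R : realType) (alpha u a b w : R) (f : R -> R) :
  1 < alpha -> 0 < u -> a < b ->
  measurable_fun (`[a, b[ : set R) f -> (forall t, `[a, b[%classic t -> 0 < f t) ->
  (\int[lebesgue_measure]_(t in `[a, b[) (f t)%:E = w%:E)%E ->
  ((alpha * u `^ (alpha - 1) * w - (alpha - 1) * u `^ alpha * (b - a))%:E <=
    \int[lebesgue_measure]_(t in `[a, b[) ((f t) `^ alpha)%:E)%E.
Proof.
move=> a1 u0 ab mf f0 fw.
have c0 : 0 <= alpha * u `^ (alpha - 1) by rewrite mulr_ge0 ?powR_ge0 //; lra.
have d0 : 0 <= (alpha - 1) * u `^ alpha by rewrite mulr_ge0 ?powR_ge0 //; lra.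
have mp : measurable_fun (`[a, b[ : set R) (EFin \o (fun t => f t `^ alpha)).
  by apply/measurable_EFinP; exact: (measurableT_comp (measurable_powR alpha) mf).
have mI : measurable (`[a, b[ : set R) by [].
have mu : lebesgue_measure (`[a, b[ : set R) = (b - a)%:E.
  by rewrite lebesgue_measure_itv /= lte_fin ab.
have I1 : (\int[lebesgue_measure]_(t in `[a, b[) ((alpha * u `^ (alpha - 1))%:E * (f t)%:E) =
    (alpha * u `^ (alpha - 1) * w)%:E)%E.
  rewrite ge0_integralZl_EFin //; first by rewrite fw.
  - by move=> t ht; rewrite lee_fin ltW // f0.
  - exact/measurable_EFinP.
have I2 : (\int[lebesgue_measure]_(t in `[a, b[) (((f t) `^ alpha)%:E + ((alpha - 1) * u `^ alpha)%:E) =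
    \int[lebesgue_measure]_(t in `[a, b[) ((f t) `^ alpha)%:E +
    ((alpha - 1) * u `^ alpha * (b - a))%:E)%E.
  rewrite ge0_integralD //.
  - congr (_ + _)%E; apply: etrans (integral_cst lebesgue_measure mI _) _.
    by rewrite [RHS]EFinM; congr (_ * _)%E; exact: mu.
  - by move=> t ht; rewrite lee_fin powR_ge0.
(* With the subtracted constant moved to the other side all integrands are nonnegative, and the
   energy may be infinite. *)
rewrite EFinB leeBlDr // -I1 -I2.
apply: ge0_le_integral => //.
- by move=> t ht; apply: mule_ge0; rewrite lee_fin // ltW // f0.
- by apply: measurable_funeM; apply/measurable_EFinP.
- by apply: emeasurable_funD.
- by move=> t ht; rewrite -EFinM -EFinD lee_fin powR_tangent // ltW // f0.
Qed.

(** The lengths are the Lebesgue measures of disjoint subsets of [[a, b]]. *)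
Lemma sum_disjoint_itv (R : realType) (n : nat) (P : pred 'I_n) (a b : R) (f g : 'I_n -> R) :
  (forall i, P i -> [/\ a <= f i, f i < g i & g i <= b]) -> a <= b ->
  (forall i j t, P i -> P j -> f i <= t < g i -> f j <= t < g j -> i = j) ->
  \sum_(i < n | P i) (g i - f i) <= b - a.
Proof.
move=> hin ab disj; pose F (i : 'I_n) : set R := `[f i, g i[%classic.
have mF i : P i -> measurable (F i) by move=> _; exact: measurable_itv.
have tF : trivIset P F.
  move=> i j Pi Pj [t [hi hj]]; move: hi hj; rewrite /F /= !in_itv /=; exact: disj.
have := @measure_bigsetU_ord_cond _ _ _ (@lebesgue_measure R) n P F mF tF.
have -> : (\sum_(i < n | P i) lebesgue_measure (F i) = (\sum_(i < n | P i) (g i - f i))%:E)%E.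
  rewrite -sumEFin; apply: eq_bigr => i Pi; have [_ fg _] := hin _ Pi.
  by rewrite lebesgue_measure_itv /= lte_fin fg.
move=> E; rewrite -lee_fin -E.
have <- : lebesgue_measure (`[a, b] : set R) = (b - a)%:E.
  rewrite lebesgue_measure_itv /= lte_fin; case: ltP => // ba.
  have -> : a = b by apply/eqP; rewrite eq_le ab ba.
  by rewrite subrr.
apply: le_measure; rewrite ?inE //.
  by apply: bigsetU_measurable.
apply: (big_ind (fun X : set R => X `<=` `[a, b]%classic)) => [t []|A B hA hB t|i Pi t].
  by case; [exact: hA|exact: hB].
rewrite /F /= !in_itv /= => /andP[h1 h2]; have [h3 _ h4] := hin _ Pi.
by rewrite (le_trans h3 h1) /= (le_trans (ltW h2) h4).
Qed.

Lemma card_ord_mem (m : nat) (l : seq nat) : uniq l -> (forall p, p \in l -> (p < m)%N) ->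
  #|[set p : 'I_m | (p : nat) \in l]%SET| = size l.
Proof.
move=> ul lm; rewrite cardsE cardE /enum_mem -enumT size_filter.
rewrite -(count_map val (mem l)) val_enum_ord -size_filter; apply: perm_size.
apply: uniq_perm => //; first by rewrite filter_uniq ?iota_uniq.
move=> p; rewrite mem_filter mem_iota add0n /=.
by case pl : (p \in l) => //=; rewrite lm.
Qed.

Section Energy.
Variables (R : realType) (alpha : R) (n m : nat) (sigma : schedule R n m).

(** Exchanging the sums over processors and jobs counts each job once per processor. *)
Lemma energy_ge (e : 'I_n -> R) :
  (forall j, ((e j)%:E <= \int[lebesgue_measure]_(t in exec_itv sigma j)
       ((speed sigma j t) `^ alpha)%:E)%E) ->
  ((\sum_(j < n) #|procs sigma j|%:R * e j)%:E <= energy alpha sigma)%E.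
Proof.
move=> he; rewrite /energy.
have -> : \sum_(j < n) #|procs sigma j|%:R * e j =
    \sum_(p < m) \sum_(j < n | p \in procs sigma j) e j.
  rewrite (exchange_big_dep xpredT) //=; apply: eq_bigr => j _.
  by rewrite sumr_const mulr_natl.
rewrite -sumEFin; apply: lee_sum => p _; rewrite -sumEFin; apply: lee_sum => j _.
exact: he.
Qed.

Lemma energy_constant (v w : 'I_n -> R) :
  (forall j, 0 < v j) -> (forall j, 0 < w j) ->
  (forall j, finish sigma j = start sigma j + w j / v j) ->
  (forall j t, speed sigma j t = v j) ->
  energy alpha sigma =
    (\sum_(j < n) #|procs sigma j|%:R * (w j * v j `^ (alpha - 1)))%:E.
Proof.
move=> v0 w0 hf hs.
have -> : \sum_(j < n) #|procs sigma j|%:R * (w j * v j `^ (alpha - 1)) =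
    \sum_(p < m) \sum_(j < n | p \in procs sigma j) w j * v j `^ (alpha - 1).
  rewrite [RHS](exchange_big_dep xpredT) //=; apply: eq_bigr => j _.
  by rewrite sumr_const mulr_natl.
rewrite /energy -sumEFin; apply: eq_bigr => p _; rewrite -sumEFin; apply: eq_bigr => j _.
under eq_integral do rewrite hs.
have mI : measurable (exec_itv sigma j) by rewrite /exec_itv.
have mu : lebesgue_measure (exec_itv sigma j) = (w j / v j)%:E.
  rewrite /exec_itv lebesgue_measure_itv /= lte_fin hf ltrDl divr_gt0 // -EFinB.
  by congr EFin; rewrite addrAC subrr add0r.
apply: etrans (integral_cst lebesgue_measure mI _) _.
transitivity ((v j `^ alpha)%:E * (w j / v j)%:E)%E; first by congr (_ * _)%E; exact: mu.
rewrite -EFinM; congr EFin; rewrite mulrCA; congr (_ * _).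
rewrite powRB ?powRr1 ?(ltW (v0 j)) //.
by rewrite (gt_eqF (v0 j)) implybT.
Qed.

End Energy.

(** * Running time and correctness of the program *)

Definition program (reversed : bool) : cmd :=
  Seq windows_cmd (Seq ranks_cmd (Seq speeds_cmd (schedule_cmd reversed))).

(** Loops are nested to depth 2, and [(n + 1)^2 <= 4 * n^2] for positive [n]. *)
Lemma program_quadratic (R : realType) reversed :
  (fun n : nat => (cost_bound n (program reversed))%:R : R^o) =O_\oo
    (fun n : nat => (n ^ 2)%:R : R^o).
Proof.
pose K := cost_bound 0 (program reversed).
apply/eqO_exP; exists (4 * K.+1)%:R; first by rewrite ltr0n.
near=> n.
have n1 : (0 < n)%N by near: n; exists 1%N.
rewrite !ger0_norm // -natrM ler_nat.
have dE : loop_depth (program reversed) = 2%N by case: (reversed).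
have := cost_bound_polynomial n (program reversed); rewrite -/K dE => /leq_trans; apply.
have : (n.+1 ^ 2 <= 4 * n ^ 2)%N by rewrite !expnS !expn0 !muln1; nia.
by move=> h; rewrite -mulnA mulnCA; apply: leq_mul.
Unshelve. all: by end_near.
Qed.

Lemma tabulateE (V : Type) (v0 : V) n (f : 'I_n -> V) (j : 'I_n) : tabulate v0 f j = f j.
Proof. by rewrite /tabulate valK. Qed.

Lemma sum_sorting (R : realType) n (D : nat -> R) pi (F : nat -> R) : sorting n D pi ->
  \sum_(0 <= k < n) F (pi k) = \sum_(j < n) F j.
Proof.
move=> [pi_n inj _ _].
pose f (k : 'I_n) : 'I_n := Ordinal (pi_n _ (ltn_ord k)).
have f_inj : injective f.
  by move=> i j /(congr1 val) /= E; apply/val_inj/inj => //; apply: ltn_ord.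
rewrite big_mkord [RHS](reindex f) //.
exact: onW_bij (injF_bij f_inj).
Qed.

Section Correctness.
Variables (R : realType) (alpha : R) (I : instance R) (reversed : bool).
Hypotheses (alpha1 : 1 < alpha) (validI : valid I) (halfI : half_size I).
Hypothesis commonI : if reversed then common_deadline I else common_release I.

Let n := njobs I.
Let m := nprocs I.
Let r := tabulate 0 (@release R I).
Let d := tabulate 0 (@deadline R I).
Let W := tabulate 0 (@work R I).
Let sz := tabulate 0%N (@jsize R I).
Let D i := d i - r i.

Let m0 : (0 < m)%N. Proof. by case: validI. Qed.

Let job_valid i : (i < n)%N ->
  [/\ 0 < D i, 0 < W i, (0 < sz i)%N, (sz i <= m)%N & ((sz i).*2 <= m)%N].
Proof.
move=> ilt; pose j := Ordinal ilt; have [_ /(_ j) [rd w s1 s2]] := validI.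
rewrite /D /d /r /W /sz -[i]/(val j) !tabulateE subr_gt0; split=> //.
have := halfI j; rewrite ler_pdivlMr // -natrM ler_nat; lia.
Qed.

Let D0 i : (i < n)%N -> 0 < D i. Proof. by case/job_valid. Qed.
Let W0 i : (i < n)%N -> 0 < W i. Proof. by case/job_valid. Qed.
Let sz0 i : (i < n)%N -> (0 < sz i)%N. Proof. by case/job_valid. Qed.
Let sz_half i : (i < n)%N -> ((sz i).*2 <= m)%N. Proof. by case/job_valid. Qed.

(** [v] and [S] are indexed by EDF position, whereas the memory is indexed by job. *)
Definition solution (s : state R) (pi : nat -> nat) (v S : nat -> R) : Prop :=
  [/\ sorting n D pi,
      forall k, (k < n)%N -> 0 < v k,
      forall y, capacity_ok n m%:R (D \o pi) (fun k => (sz (pi k))%:R) y ->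
        \sum_(0 <= k < n) v k `^ alpha * (y k - (sz (pi k))%:R * W (pi k) / v k) <= 0,
      forall k, (k < n)%N -> job_ok m sz r d W D pi reversed v s k (S k)
    & forall i i' p, (i < i' < n)%N -> p \in job_procs s (pi i) ->
        p \in job_procs s (pi i') -> S i + duration m W pi v i <= S i'].

Lemma program_spec : ends n (program reversed) (load I) (fun s =>
  exists pi v S, solution s pi v S).
Proof.
have inp0 : inputs n m sz r d W (load I) by [].
apply/ends_seq/ends_frame/(ends_mono _ (windows_spec (leqnn n) inp0)) => s1 h1 fr1.
have inp1 := inputs_frame fr1 isT inp0.
apply/ends_seq/ends_frame/(ends_mono _ (ranks_spec (leqnn n) inp1 h1)) => s2 srt fr2.
have prep2 : prepared n m sz r d W D (imem s2 7) s2.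
  split=> //; first exact: inputs_frame fr2 isT inp1.
  by move=> i iN; rewrite fr2.2 // h1.
have v2 i : rmem s2 5 i = 0 by rewrite fr2.2 // fr1.2.
apply/ends_seq/ends_frame.
apply: (ends_mono _ (@speeds_spec R alpha n n m sz r d W D (imem s2 7) (leqnn n)
  alpha1 m0 D0 W0 sz0 srt s2 prep2 v2)) => s3 inv fr3.
set pi := imem s2 7 in srt prep2 inv.
have [pi_n _ _ _] := srt.
have m0' : 0 < m%:R :> R by rewrite ltr0n.
have [vpos varea vdual] := speed_inv_final alpha1 m0'
  (fun i h => D0 (pi_n i h)) (fun i h => W0 (pi_n i h)) inv.
have prep3 : prepared n m sz r d W D pi s3 by apply: prepared_frame fr3 _ _ _ prep2.
set v := base_speed n pi s3 in vpos varea vdual.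
have v0 k : (k < n)%N -> 0 < v k by case/vpos.
have hv k : (k < n)%N -> rmem s3 5 (pi k) = v k by rewrite /v /base_speed => ->.
apply: (ends_mono _ (@schedule_spec R n n m sz r d W D pi reversed v (leqnn n) m0 W0 sz0
  sz_half srt v0 (fun k h => (vpos k h).2) varea D0 s3 prep3 hv _ _ _)) => [s4 [S [ok disj]]|||].
- by exists pi, v, S; split.
- by rewrite fr3.1 // fr2.1 // fr1.1.
- by rewrite fr3.1 // fr2.1 // fr1.1.
- by rewrite fr3.2 // fr2.2 // fr1.2.
Qed.

Section Solution.
Variables (s : state R) (pi : nat -> nat) (v S : nat -> R).
Hypothesis sol : solution s pi v S.

Let c := scale R m.
Let c0 : 0 < c. Proof. exact: scale_gt0. Qed.
Let sigma := output I s.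

Lemma position (j : 'I_n) : exists2 k, (k < n)%N & pi k = j.
Proof. by have [[_ _ h _] _ _ _ _] := sol; apply: h. Qed.

Let ok (j : 'I_n) k : (k < n)%N -> pi k = j ->
  [/\ size (job_procs s j) = sz j, uniq (job_procs s j),
      forall p, p \in job_procs s j -> (p < m)%N
    & [/\ 0 <= S k, S k + duration m W pi v k <= D j, rmem s 4 j = c * v k
        & rmem s 3 j = start_time r d reversed j (S k) (duration m W pi v k)]].
Proof. by move=> kn <-; have [_ _ _ h _] := sol; apply: h. Qed.

Let dur0 k : (k < n)%N -> 0 < duration m W pi v k.
Proof.
move=> kn; have [[pi_n _ _ _] v0 _ _ _] := sol.
by rewrite divr_gt0 ?W0 ?pi_n // mulr_gt0 ?v0.
Qed.

Lemma output_procs (j : 'I_n) :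
  procs sigma j = [set p : 'I_m | (p : nat) \in job_procs s j]%SET.
Proof.
apply/setP => p; rewrite !inE; apply/existsP/mem_procs_of.
  move=> [q pq]; exists (cell s (imem s 3 j + q)).
    apply/mapP; exists (imem s 3 j + q)%N => //.
    by rewrite mem_index_iota leq_addr ltn_add2l /=.
  by rewrite mem_index_iota.
move=> [b /mapP[i]]; rewrite mem_index_iota => /andP[i1 i2 ->].
rewrite mem_index_iota => pi'.
have iq : (i - imem s 3 j < imem s 4 j)%N by lia.
by exists (Ordinal iq); rewrite /= subnKC.
Qed.

Lemma output_card (j : 'I_n) : #|procs sigma j| = jsize j.
Proof.
have [k kn pk] := position j; have [h1 h2 h3 _] := ok kn pk.
by rewrite output_procs card_ord_mem // h1 /sz tabulateE.
Qed.

Lemma output_finish (j : 'I_n) k : (k < n)%N -> pi k = j ->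
  finish sigma j = start sigma j + duration m W pi v k.
Proof.
move=> kn pk; have [_ _ _ [_ _ h _]] := ok kn pk.
by rewrite /= h /duration pk /W tabulateE.
Qed.

Lemma output_feasible : feasible sigma.
Proof.
split.
- exact: output_card.
- move=> j; have [k kn pk] := position j.
  have [_ _ _ [S0 SD h4 h3]] := ok kn pk; have P0 := dur0 kn.
  rewrite (output_finish kn pk) /= h3 /start_time /r /d !tabulateE.
  move: SD; rewrite /D /r /d !tabulateE.
  by case: (reversed) => SD; split; lra.
- move=> j; have [k kn pk] := position j.
  have [_ _ _ [S0 SD h4 h3]] := ok kn pk; have P0 := dur0 kn.
  have [_ v0 _ _ _] := sol.
  have sp : 0 < rmem s 4 j by rewrite h4 mulr_gt0 ?v0.
  split; [exact: measurable_cst|by []|].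
  have mI : measurable (exec_itv sigma j) by exact: measurable_itv.
  have mu : lebesgue_measure (exec_itv sigma j) = (duration m W pi v k)%:E.
    rewrite /exec_itv lebesgue_measure_itv /= lte_fin.
    rewrite -[rmem s 3 j + _]/(finish sigma j) (output_finish kn pk) /= ltrDl P0 -EFinB.
    by congr EFin; rewrite addrAC subrr add0r.
  apply: etrans (integral_cst lebesgue_measure mI (rmem s 4 j)%:E) _.
  transitivity ((rmem s 4 j)%:E * (duration m W pi v k)%:E)%E.
    by congr (_ * _)%E; exact: mu.
  rewrite -EFinM; congr EFin; rewrite h4 /duration pk -/c /W tabulateE.
  by field; rewrite !gt_eqF ?v0.
(* The job at the later position starts after the other has ended. With a common deadline both
   intervals are reflected in the same way and stay disjoint. *)
- have key (p : 'I_m) t (j k : 'I_n) a b : (a < n)%N -> (b < n)%N -> pi a = j -> pi b = k ->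
      (a < b)%N -> p \in procs sigma j -> p \in procs sigma k ->
      exec_itv sigma j t -> exec_itv sigma k t -> False.
    move=> an bn pa pb ab; rewrite !output_procs !inE => hj hk.
    have [_ _ _ _ disj] := sol.
    have := disj a b p; rewrite ab pa pb => /(_ bn hj hk) h.
    rewrite /exec_itv /= !in_itv /=.
    rewrite -![rmem s 3 _ + _]/(finish sigma _) (output_finish an pa) (output_finish bn pb) /=.
    have [_ _ _ [_ _ _ ->]] := ok an pa; have [_ _ _ [_ _ _ ->]] := ok bn pb.
    rewrite /start_time /r /d !tabulateE => /andP[h1 h2] /andP[h3 h4].
    move: commonI h1 h2 h3 h4; case: (reversed) => -[x hx]; rewrite !hx; lra.
  move=> p t j k pj pk tj tk.
  have [a an pa] := position j; have [b bn pb] := position k.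
  apply/val_inj; case: (ltngtP a b) => ab.
  + by case: (key p t j k a b).
  + by case: (key p t k j b a).
  + by apply: etrans (esym pa) _; rewrite ab.
Qed.

(** The value of the relaxation: the energy at the unscaled speeds [v]. *)
Let opt : R := \sum_(0 <= k < n) (sz (pi k))%:R * (W (pi k) * v k `^ (alpha - 1)).

Lemma output_energy : energy alpha sigma = (c `^ (alpha - 1) * opt)%:E.
Proof.
have [srt v0 _ _ _] := sol.
have sp (j : 'I_n) : 0 < rmem s 4 j.
  have [k kn pk] := position j; have [_ _ _ [_ _ -> _]] := ok kn pk.
  by rewrite mulr_gt0 ?v0.
rewrite (@energy_constant _ alpha _ _ sigma (fun j => rmem s 4 j) (fun j => work j)) //;
  last by move=> j; have [_ /(_ j)[]] := validI.
congr EFin.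
rewrite (eq_bigr (fun j : 'I_n => (sz j)%:R * (W j * rmem s 4 j `^ (alpha - 1)))); last first.
  by move=> j _; rewrite output_card /sz /W !tabulateE.
rewrite -(sum_sorting (fun j => (sz j)%:R * (W j * rmem s 4 j `^ (alpha - 1))) srt).
rewrite /opt mulr_sumr; apply: eq_big_nat => k /andP[_ kn].
have [_ _ _ h _] := sol; have [_ _ _ [_ _ -> _]] := h _ kn.
by rewrite powRM ?(ltW c0) ?(ltW (v0 _ kn)) // -/c; ring.
Qed.

(** The lower bound uses the common release time or deadline here: windows anchored at one point and
    no longer than [t] fit into one interval of length [t]. *)
Lemma window_packing (t : R) : exists a, forall j : 'I_n,
  deadline j - release j <= t -> a <= release j /\ deadline j <= a + t.
Proof.
move: commonI; case: (reversed) => -[x hx].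
  by exists (x - t) => j; rewrite hx => h; split; lra.
by exists x => j; rewrite hx => h; split; lra.
Qed.

(** Let [y] be the processor times in [tau] and [x] those at the speeds [v]. The tangent bounds at
    [v] add up to [opt] minus [alpha - 1] times the sum of [v ^ alpha * (y - x)], and this sum is at
    most 0 since [y] is admissible. *)
Lemma energy_lower_bound (tau : schedule R n m) : feasible tau ->
  (opt%:E <= energy alpha tau)%E.
Proof.
move=> [hcard hwin hspeed hdisj].
have [srt v0 dual _ _] := sol; have [pi_n inj onto edf] := srt.
pose len := tabulate 0 (fun j : 'I_n => finish tau j - start tau j).
pose y k : R := (sz (pi k))%:R * len (pi k).
have capy : capacity_ok n m%:R (D \o pi) (fun k => (sz (pi k))%:R) y.
  split; last first.
    move=> i ilt; rewrite /y ler_wpM2l //= /len /D -[pi i]/(val (Ordinal (pi_n _ ilt))).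
    rewrite /r /d !tabulateE; have [h1 h2 h3] := hwin (Ordinal (pi_n _ ilt)); lra.
  (* The first [k.+1] jobs have windows no longer than [D (pi k)], so they all run within one
     interval of that length on [m] processors. *)
  move=> k kn /=; have Dk := D0 (pi_n _ kn); have [a ha] := window_packing (D (pi k)).
  pose Q (j : 'I_n) := D j <= D (pi k).
  have inQ (j : 'I_n) : Q j -> a <= start tau j /\ finish tau j <= a + D (pi k).
    rewrite /Q {1}/D /r /d !tabulateE => /ha[h1 h2]; have [h3 h4 h5] := hwin j.
    by split; [exact: le_trans h3|exact: le_trans h5 h2].
  have len0 (j : 'I_n) : 0 <= len j.
    by rewrite /len tabulateE subr_ge0 ltW //; have [] := hwin j.
  apply: (@le_trans _ _ (\sum_(j < n | Q j) (sz j)%:R * len j)).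
    pose G j : R := if D j <= D (pi k) then (sz j)%:R * len j else 0.
    rewrite [leRHS]big_mkcond /= -(sum_sorting G srt) [leRHS](big_cat_nat (n := k.+1)) //=.
    rewrite -[leLHS]addr0; apply: lerD.
      rewrite !big_nat; apply: ler_sum => i /andP[_ ik]; rewrite /G edf //.
    rewrite big_nat sumr_ge0 // => i /andP[_ iN]; rewrite /G; case: ifP => // _.
    by rewrite mulr_ge0 // (len0 (Ordinal (pi_n _ iN))).
  have -> : \sum_(j < n | Q j) (sz j)%:R * len j =
      \sum_(p < m) \sum_(j < n | Q j && (p \in procs tau j)) (finish tau j - start tau j).
    rewrite [RHS](exchange_big_dep Q) /=; last by move=> p j _ /andP[].
    apply: eq_bigr => j Qj; rewrite Qj /= sumr_const mulr_natl hcard.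
    by rewrite /sz /len !tabulateE.
  have -> : m%:R * D (pi k) = \sum_(p < m) D (pi k).
    by rewrite sumr_const card_ord mulr_natl.
  apply: ler_sum => p _; have := @sum_disjoint_itv R n
    (fun j => Q j && (p \in procs tau j)) a (a + D (pi k)) (start tau) (finish tau).
  rewrite (_ : a + D (pi k) - a = D (pi k)); last by rewrite addrAC subrr add0r.
  apply.
  - by move=> j /andP[/inQ[h1 h2] _]; split=> //; have [] := hwin j.
  - by rewrite lerDl ltW.
  - move=> i j t /andP[_ pi1] /andP[_ pj] ti tj; apply: (hdisj p t) => //;
      by rewrite /exec_itv /= in_itv /=.
(* The quotient by [c] recovers the unscaled speed, now indexed by job. *)
have u0 (j : 'I_n) : 0 < rmem s 4 j / c.
  have [k kn pk] := position j; have [_ _ _ [_ _ -> _]] := ok kn pk.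
  by rewrite divr_gt0 // mulr_gt0 ?v0.
pose u j := rmem s 4 j / c.
pose e j : R := alpha * u j `^ (alpha - 1) * W j - (alpha - 1) * u j `^ alpha * len j.
apply: le_trans (@energy_ge R alpha n m tau (fun j => e j) _); last first.
  move=> j; have [mf f0 fw] := hspeed j; have [_ h _] := hwin j.
  rewrite /e /len /W !tabulateE; exact: (integral_powR_ge alpha1 (u0 j) h mf f0 fw).
rewrite lee_fin.
rewrite (eq_bigr (fun j : 'I_n => (sz j)%:R * e j)); last first.
  by move=> j _; rewrite hcard /sz tabulateE.
rewrite -(sum_sorting (fun j => (sz j)%:R * e j) srt).
have := dual y capy; rewrite -(pmulr_rle0 _ (_ : 0 < alpha - 1)) ?subr_gt0 //.
rewrite mulr_sumr -subr_ge0 sub0r => h; rewrite -subr_ge0.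
apply: le_trans h _; rewrite -sumrN /opt -sumrB.
apply: ler_sum_nat => k /andP[_ kn].
have [_ _ _ h _] := sol; have [_ _ _ [_ _ h4 _]] := h _ kn.
have uE : u (pi k) = v k by rewrite /u h4 mulrAC divff ?mul1r ?gt_eqF.
rewrite /e uE /y.
have -> : v k `^ alpha = v k * v k `^ (alpha - 1).
  rewrite powRB; last by rewrite (gt_eqF (v0 _ kn)) implybT.
  by rewrite powRr1 ?(ltW (v0 _ kn)) // mulrCA divff ?mulr1 // gt_eqF ?v0.
rewrite le_eqVlt; apply/orP/or_introl/eqP; field; by rewrite gt_eqF ?v0.
Qed.

Lemma output_ratio :
  (energy alpha sigma <= (c `^ (alpha - 1))%:E * min_energy alpha I)%E.
Proof.
rewrite output_energy EFinM lee_pmul2l ?lte_fin ?powR_gt0 //.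
by apply: le_ereal_inf_tmp => _ [tau ftau <-]; apply: energy_lower_bound.
Qed.

End Solution.

Lemma program_correct : exists (s : state R) (t : nat),
  [/\ exec (program reversed) (load I) s t,
      (t <= cost_bound n (program reversed))%N,
      feasible (output I s)
    & (energy alpha (output I s)
         <= ((3 - 4 / (m%:R + 1)) `^ (alpha - 1))%:E * min_energy alpha I)%E].
Proof.
have [s [t [h1 h2 [pi [v [S sol]]]]]] := program_spec; exists s, t; split=> //.
  exact: output_feasible sol.
exact: output_ratio sol.
Qed.

End Correctness.

Theorem theorem3 (R : realType) (alpha : R) (halpha : 1 < alpha) :
  let rho := fun m : nat => (3 - 4 / (m%:R + 1)) `^ (alpha - 1) : R in
  quadratic_approx_alg alpha rho
    (fun I : instance R => half_size I /\ common_release I) /\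
  quadratic_approx_alg alpha rho
    (fun I : instance R => half_size I /\ common_deadline I).
Proof.
move=> rho; split.
  exists (program false), (fun n => cost_bound n (program false)).
  split; first exact: program_quadratic.
  by move=> I vI [hI cI]; apply: (@program_correct _ _ _ false).
exists (program true), (fun n => cost_bound n (program true)).
split; first exact: program_quadratic.
by move=> I vI [hI cI]; apply: (@program_correct _ _ _ true).
Qed.
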